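(* Let $\gamma$ be a simple closed curve in the plane $\mathbb{R}^2$ of length $L$, enclosing a domain $D$ of area $A$. Then $L^{2} \geq 4\pi A$, with equality if and only if $\gamma$ is a circle.
   Context: The curve $\gamma$ has a (finite) length $L$, i.e. it is a rectifiable simple closed curve. The domain $D$ enclosed by $\gamma$ is the bounded component of $\mathbb{R}^2 \setminus \gamma$. *)

(* Defs.v *)
From mathcomp Require Import all_boot all_order all_algebra.
From mathcomp Require Import all_classical all_reals all_analysis.

Set Implicit Arguments.
Unset Strict Implicit.
Unset Printing Implicit Defensive.

Import Order.TTheory GRing.Theory Num.Theory.
Import numFieldNormedType.Exports.

Local Open Scope classical_set_scope.
Local Open Scope ring_scope.

(* The library norm on R * R is the max norm, which gives the right topology
   and bounded sets but not the Euclidean lengths. *)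
Definition eucl_dist (R : realType) (p q : R * R) : R :=
  Num.sqrt ((p.1 - q.1) ^+ 2 + (p.2 - q.2) ^+ 2).

Definition simple_closed_curve (R : realType) (a b : R) (g : R -> R * R) :=
  [/\ a < b,
      {within `[a, b], continuous g},
      g a = g b &
      {in `[a, b[ &, injective g}].

(* Length of the polygonal line g a, g s_0, g s_1, ..., as in [variation]. *)
Definition polygonal_length (R : realType) (a : R) (g : R -> R * R)
    (s : seq R) : R :=
  \sum_(0 <= n < size s)
    eucl_dist (g (nth a (a :: s) n)) (g (nth a (a :: s) n.+1)).

Definition curve_length (R : realType) (a b : R) (g : R -> R * R) : \bar R :=
  ereal_sup [set (polygonal_length a g s)%:E | s in itv_partition a b].

Definition trace (R : realType) (a b : R) (g : R -> R * R) : set (R * R) :=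
  g @` `[a, b].

(* By the Jordan curve theorem the complement of a simple closed curve has
   exactly one bounded component. *)
Definition enclosed_domain (R : realType) (a b : R) (g : R -> R * R)
    (D : set (R * R)) :=
  bounded_set D /\
  exists2 x, (~` trace a b g) x & D = connected_component (~` trace a b g) x.

Definition area (R : realType) (D : set (R * R)) : \bar R :=
  (@lebesgue_measure R \x @lebesgue_measure R)%E D.

Definition is_circle (R : realType) (C : set (R * R)) :=
  exists (c : R * R) (r : R), 0 < r /\ C = [set p | eucl_dist p c = r].

(* Main.v *)
Require Import Defs.
From mathcomp Require Import all_boot all_order all_algebra.
From mathcomp Require Import all_classical all_reals all_analysis.
From mathcomp Require Import measurable_realfun ring lra.
(** For [t > 0], call a centre [x] straddling if the curve has points both at
    distance less than [t] and at distance more than [t] from [x]. Along a closed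
    inscribed polygon, a disc containing some but not all of the vertices is left
    along some edge, and the centres of the discs of radius [t] left along an edge
    of length [l] have measure at most [2 t l]; hence the straddling centres have
    measure at most [2 t L].

    Let [r] be such that [D] has area [pi r^2]. If [t < r] and [D] contains no
    disc of radius [t], then every point at distance less than [t] from [D] is
    straddling, and the Brunn-Minkowski inequality for [D] and a disc yields
    [pi (r + t)^2 <= 2 t L], so that [2 pi r < L]. Otherwise, by compactness, [D]
    contains a disc of radius [r], hence is equal to it, and its boundary circle
    lies on the curve. All points at distance less than [2 r] from the centre of
    [D], except that centre, are then straddling for [t = r], which gives
    [2 pi r <= L]; a point of the curve outside the circle would produce further
    straddling centres and make the inequality strict. *)

Set Implicit Arguments.
Unset Strict Implicit.
Unset Printing Implicit Defensive.

Import Order.TTheory GRing.Theory Num.Theory.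
Import numFieldNormedType.Exports.

Local Open Scope classical_set_scope.
Local Open Scope ring_scope.

(** * The Euclidean plane *)

Lemma ler_of_sqr (R : realDomainType) (x y : R) : 0 <= y -> x ^+ 2 <= y ^+ 2 -> x <= y.
Proof. by move=> y0 xy; rewrite leNgt; apply/negP => yx; nra. Qed.

Section euclidean_plane.
Context {R : realType}.
Implicit Types (p q c x : R * R) (t r : R).

Definition disc c t : set (R * R) := [set x | eucl_dist x c < t].

Lemma eucl_dist_ge0 p q : 0 <= eucl_dist p q.
Proof. exact: sqrtr_ge0. Qed.

Lemma eucl_dist_sqr p q :
  eucl_dist p q ^+ 2 = (p.1 - q.1) ^+ 2 + (p.2 - q.2) ^+ 2.
Proof. by rewrite sqr_sqrtr// addr_ge0// sqr_ge0. Qed.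

Lemma eucl_distC p q : eucl_dist p q = eucl_dist q p.
Proof. by rewrite /eucl_dist; congr Num.sqrt; ring. Qed.

Lemma eucl_distxx p : eucl_dist p p = 0.
Proof. by rewrite /eucl_dist !subrr expr0n/= addr0 sqrtr0. Qed.

Lemma eucl_dist_lt p q t : 0 < t ->
  (eucl_dist p q < t) = ((p.1 - q.1) ^+ 2 + (p.2 - q.2) ^+ 2 < t ^+ 2).
Proof.
by move=> t0; rewrite -eucl_dist_sqr ltr_pXn2r// ?nnegrE ?eucl_dist_ge0// ltW.
Qed.

Lemma eucl_dist_triangle m p q :
  eucl_dist p q <= eucl_dist p m + eucl_dist m q.
Proof.
apply: ler_of_sqr; first by rewrite addr_ge0 ?eucl_dist_ge0.
rewrite sqrrD !eucl_dist_sqr.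
set a := p.1 - m.1; set b := p.2 - m.2; set c := m.1 - q.1; set d := m.2 - q.2.
have -> : p.1 - q.1 = a + c by rewrite /a /c; ring.
have -> : p.2 - q.2 = b + d by rewrite /b /d; ring.
have : a * c + b * d <= eucl_dist p m * eucl_dist m q.
  apply: ler_of_sqr; first by rewrite mulr_ge0 ?eucl_dist_ge0.
  rewrite exprMn !eucl_dist_sqr -/a -/b -/c -/d.
  have : 0 <= (a * d - b * c) ^+ 2 by rewrite sqr_ge0.
  nra.
rewrite -mulr_natl; lra.
Qed.

Lemma eucl_dist_ge1 p q : `|p.1 - q.1| <= eucl_dist p q.
Proof.
apply: ler_of_sqr; first exact: eucl_dist_ge0.
by rewrite eucl_dist_sqr real_normK ?num_real// lerDl sqr_ge0.
Qed.

Lemma eucl_dist_ge2 p q : `|p.2 - q.2| <= eucl_dist p q.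
Proof.
apply: ler_of_sqr; first exact: eucl_dist_ge0.
by rewrite eucl_dist_sqr real_normK ?num_real// lerDr sqr_ge0.
Qed.

Lemma eucl_dist_le_sum p q : eucl_dist p q <= `|p.1 - q.1| + `|p.2 - q.2|.
Proof.
apply: ler_of_sqr; first by rewrite addr_ge0.
rewrite eucl_dist_sqr [leRHS]sqrrD !real_normK ?num_real//.
by rewrite lerD2r lerDl mulrn_wge0// mulr_ge0.
Qed.

Lemma ball_disc c e : ball c e `<=` disc c (2 * e).
Proof.
move=> x [/= x1 x2]; rewrite /disc/=.
apply: (le_lt_trans (eucl_dist_le_sum _ _)).
by rewrite mulr2n mulrDl mul1r ltrD// distrC.
Qed.

Lemma disc_ball c e : disc c e `<=` ball c e.
Proof.
by move=> x xc; split => /=; rewrite /ball/= distrC;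
   apply: le_lt_trans xc; [exact: eucl_dist_ge1|exact: eucl_dist_ge2].
Qed.

(** The topology on pairs comes from the max norm; squares and Euclidean discs nest in each other up
    to a factor 2, so both give the same neighbourhoods. *)
Lemma nbhs_discP c (A : set (R * R)) :
  nbhs c A <-> exists2 e, 0 < e & disc c e `<=` A.
Proof.
split=> [/nbhs_ballP[e /= e0 eA]|[e e0 eA]].
  by exists e => //; exact: subset_trans (@disc_ball _ _) eA.
apply/nbhs_ballP; exists (e / 2) => /=; first by rewrite divr_gt0.
apply: subset_trans eA; have := @ball_disc c (e / 2).
by rewrite (mulrC 2) divfK ?pnatr_eq0.
Qed.

Lemma disc_open c t : open (disc c t).
Proof.
rewrite openE => x /= xc; apply/nbhs_discP.
exists (t - eucl_dist x c); first by rewrite subr_gt0.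
move=> y; rewrite /disc/= ltrBrDr; apply: le_lt_trans.
exact: eucl_dist_triangle.
Qed.

Lemma eucl_dist_continuous p : continuous (fun x => eucl_dist x p).
Proof.
move=> x; apply/cvgrPdist_lt => e e0; apply/nbhs_discP; exists e => //.
move=> y; rewrite /disc/= => yx.
have := eucl_dist_triangle y x p; have := eucl_dist_triangle x y p.
by rewrite (eucl_distC x y) => h1 h2; rewrite ltr_norml; lra.
Qed.

Lemma open_outside_disc c t : open [set x | t < eucl_dist x c].
Proof.
apply: (@open_comp _ _ (fun x => eucl_dist x c) [set s | t < s]).
  by move=> x _; exact: eucl_dist_continuous.
exact: open_gt.
Qed.

(** An open set is the union of the boxes with rational corners that it contains, a countable family
    of measurable rectangles. *)
Lemma open_measurable2 (A : set (R * R)) : open A ->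
  measurable (A : set (measurableTypeR R * measurableTypeR R)).
Proof.
move=> oA.
pose box (i : (rat * rat) * (rat * rat)) : set (measurableTypeR R * measurableTypeR R) :=
  `](ratr i.1.1 : R), (ratr i.1.2 : R)[ `*` `](ratr i.2.1 : R), (ratr i.2.2 : R)[.
have -> : A = \bigcup_i (if `[< box i `<=` A >] then box i else set0).
  rewrite eqEsubset; split => [x Ax|x [i _]]; last first.
    by case: ifPn => // /asboolP; exact.
  have /nbhs_ballP[e /= e0 eA] : nbhs x A by exact: open_nbhs_nbhs.
  have [|a1 /itvP a1P] := @rat_in_itvoo _ (x.1 - e) x.1; first by lra.
  have [|b1 /itvP b1P] := @rat_in_itvoo _ x.1 (x.1 + e); first by lra.
  have [|a2 /itvP a2P] := @rat_in_itvoo _ (x.2 - e) x.2; first by lra.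
  have [|b2 /itvP b2P] := @rat_in_itvoo _ x.2 (x.2 + e); first by lra.
  exists ((a1, b1), (a2, b2)) => //.
  case: ifPn => [_|/asboolP]; first by split; rewrite /= in_itv/= ?a1P ?a2P ?b1P ?b2P.
  case=> y [/=]; rewrite !in_itv/= => /andP[ya1 yb1] /andP[ya2 yb2].
  apply: eA; split; rewrite /ball/= ltr_distlC.
    by rewrite (lt_trans _ ya1) ?a1P// (lt_trans yb1) ?b1P.
  by rewrite (lt_trans _ ya2) ?a2P// (lt_trans yb2) ?b2P.
apply: countable_bigcupT_measurable => [|i].
  exact: countableP.
case: ifPn => _; last exact: measurable0.
by apply: measurableX; exact: measurable_itv.
Qed.
End euclidean_plane.

(** * Measure of discs and of their differences *)

Section line_measure.
Context {R : realType}.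
Local Notation lam := (@lebesgue_measure R).
Implicit Types (X Z : set (measurableTypeR R)) (r t : R).

(** The pushforward of the measure by a translation has the right values on half-open intervals, and
    these determine Lebesgue measure. *)
Lemma lebesgue_measure_shift X r : measurable X ->
  lam [set x | X (x + r)] = lam X.
Proof.
move=> mX.
have mf : measurable_fun setT ((fun x => x + r) : measurableTypeR R -> measurableTypeR R).
  by apply: continuous_measurable_fun => x; apply: cvgD; [exact: cvg_id|exact: cvg_cst].
suff -> : lam X = pushforward lam
  ((fun x => x + r) : measurableTypeR R -> measurableTypeR R) X by [].
apply: lebesgue_measure_unique => //= _ [[a b]] _ <-.
rewrite /pushforward.
have -> : (fun x : R => x + r) @^-1` `]a, b] = `]a - r, b - r]%classic.
  by apply/seteqP; split => x /=; rewrite !in_itv/= ltrBlDr lerBrDr.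
rewrite !lebesgue_measure_itv/= !lte_fin ltrD2r -!EFinD.
by case: ifP => // _; congr EFin; ring.
Qed.

Lemma lebesgue_measure_diam X r : 0 <= r -> measurable X ->
  (forall x y, X x -> X y -> x <= y + r) -> (lam X <= r%:E)%E.
Proof.
move=> r0 mX Xr.
have [->|/set0P[x0 Xx0]] := eqVneq X set0; first by rewrite measure0 lee_fin.
have lX : has_lbound X.
  by exists (x0 - r) => x Xx; rewrite lerBlDr; exact: Xr.
have XI : X `<=` `[inf X, inf X + r].
  move=> x Xx; rewrite /= in_itv/= ge_inf//= -lerBlDr.
  apply: lb_le_inf; first by exists x0.
  by move=> y Xy; rewrite lerBlDr; exact: Xr.
apply: (le_trans (le_measure lam (mem_set mX) (mem_set (measurable_itv _)) XI)).
rewrite [leLHS](lebesgue_measure_itv `[inf X, inf X + r])/= lte_fin.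
case: ifP => _; last by rewrite lee_fin.
by rewrite -EFinB lee_fin addrAC subrr add0r.
Qed.

(* The one-dimensional Brunn-Minkowski inequality for [X] and an interval: the
   sum contains [X] and two disjoint intervals flanking it. *)
Lemma lebesgue_measure_thicken X Z r : 0 < r -> measurable X -> measurable Z ->
  X !=set0 -> has_ubound X -> has_lbound X ->
  (forall x z, X x -> `|z - x| < r -> Z z) ->
  (lam X + (2 * r)%:E <= lam Z)%E.
Proof.
move=> r0 mX mZ X0 uX lX XZ.
have mI (a b : R) : measurable (`]a, b[ : set (measurableTypeR R)) by exact: measurable_itv.
have lamI (a : R) : lam `]a, a + r[%classic = r%:E.
  by rewrite lebesgue_measure_itv/= lte_fin ltrDl r0 -EFinB addrAC subrr add0r.
pose l : set (measurableTypeR R) := `]inf X - r, inf X - r + r[%classic.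
pose u : set (measurableTypeR R) := `]sup X, sup X + r[%classic.
have ml : measurable l by exact: mI.
have mu : measurable u by exact: mI.
have mlX : measurable (l `|` X) by exact: measurableU.
have Xl x : X x -> inf X <= x by move=> Xx; exact: ge_inf.
have Xu x : X x -> x <= sup X by move=> Xx; exact: ub_le_sup.
have lX0 : l `&` X = set0.
  by rewrite -subset0 /l => x /= []; rewrite in_itv/= => /andP[_ h] /Xl h'; lra.
have lu0 : (l `|` X) `&` u = set0.
  have [x0 Xx0] := X0; have := Xl _ Xx0; have := Xu _ Xx0 => h1 h2.
  rewrite -subset0 /l /u => x /= [[|/Xu h]]; rewrite !in_itv/=; first by lra.
  by move=> /andP[h' _]; lra.
have -> : (lam X + (2 * r)%:E = lam (l `|` X `|` u))%E.
  rewrite (measureU lam mlX mu lu0) (measureU lam ml mX lX0).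
  rewrite [X in (_ = X + _ + _)%E]lamI [X in (_ = _ + X)%E]lamI.
  by rewrite addeAC addeC -EFinD; congr (_ + _%:E)%E; ring.
apply: (le_measure lam (mem_set (measurableU _ _ mlX mu)) (mem_set mZ)).
rewrite /l /u => z /= [[|Xz]|].
- rewrite in_itv/= => /andP[h1 h2].
  (* This slack yields [x < z + r], while [z < inf X <= x]; the right flank is symmetric. *)
  have [|x Xx xh] := @inf_adherent _ X (z - (inf X - r)) _ (conj X0 lX); first by rewrite subr_gt0.
  apply: (XZ x) => //; have := Xl _ Xx.
  by rewrite ltr_norml; lra.
- by apply: (XZ z) => //; rewrite subrr normr0.
- rewrite in_itv/= => /andP[h1 h2].
  have [|x Xx xh] := @sup_adherent _ X (sup X + r - z) _ (conj X0 uX); first by rewrite subr_gt0.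
  apply: (XZ x) => //; have := Xu _ Xx.
  by rewrite ltr_norml; lra.
Qed.
End line_measure.

(** * Planar measure of strips, sheared sets and discs *)

Section plane_measure.
Context {R : realType}.
Local Notation lam := (@lebesgue_measure R).
Local Notation lam2 := (@lebesgue_measure R \x @lebesgue_measure R)%E.
Local Notation plane := (measurableTypeR R * measurableTypeR R)%type.
Implicit Types (S : set plane) (p q c : R * R) (r t k : R).

(** The product measure is defined by integrating vertical sections; the other order of integration
    gives the same values on rectangles, hence everywhere by uniqueness. *)
Lemma plane_measureE_ysection S : measurable S ->
  lam2 S = (\int[lam]_y lam (ysection S y))%E.
Proof.
move=> mS; apply: (product_measure_unique (m' := (lam \x^ lam)%E)) => // A B mA mB.
exact: product_measure2E.
Qed.

Lemma plane_measure_xstrip S a b r : a <= b -> 0 <= r -> measurable S ->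
  (forall x, S x -> a <= x.1 <= b) ->
  (forall x y z : R, S (x, y) -> S (x, z) -> y <= z + r) ->
  (lam2 S <= ((b - a) * r)%:E)%E.
Proof.
move=> ab r0 mS Sab Sr.
have mI : measurable (`[a, b]%classic : set (measurableTypeR R)) by exact: measurable_itv.
apply: (@le_trans _ _ (\int[lam]_(x in `[a, b]%classic) (cst r%:E x))%E); last first.
  rewrite integral_cst//= [X in (_ * X)%E]lebesgue_measure_itv/= lte_fin.
  case: ltP => [_|ba]; first by rewrite -EFinB -EFinM mulrC.
  by rewrite mule0 lee_fin mulr_ge0// subr_ge0.
rewrite [leRHS]integral_mkcond; apply: ge0_le_integral => //=.
- exact: (measurable_fun_xsection lam mS).
- by apply/(measurable_restrictT _ mI); exact: measurable_cst.
move=> x _; rewrite patchE; case: ifPn => [_|].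
  apply: lebesgue_measure_diam => //; first exact: measurable_xsection.
  by move=> y z; rewrite /xsection/= !inE; exact: Sr.
rewrite notin_setE/= in_itv/= => xab.
rewrite (_ : xsection S x = set0) ?measure0// -subset0 => y.
by rewrite /xsection/= inE => /Sab.
Qed.

Lemma plane_measure_ystrip S a b r : a <= b -> 0 <= r -> measurable S ->
  (forall x, S x -> a <= x.2 <= b) ->
  (forall x y z : R, S (x, z) -> S (y, z) -> x <= y + r) ->
  (lam2 S <= ((b - a) * r)%:E)%E.
Proof.
move=> ab r0 mS Sab Sr; rewrite plane_measureE_ysection//.
have mI : measurable (`[a, b]%classic : set (measurableTypeR R)) by exact: measurable_itv.
apply: (@le_trans _ _ (\int[lam]_(x in `[a, b]%classic) (cst r%:E x))%E); last first.
  rewrite integral_cst//= [X in (_ * X)%E]lebesgue_measure_itv/= lte_fin.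
  case: ltP => [_|ba]; first by rewrite -EFinB -EFinM mulrC.
  by rewrite mule0 lee_fin mulr_ge0// subr_ge0.
rewrite [leRHS]integral_mkcond; apply: ge0_le_integral => //=.
- exact: (measurable_fun_ysection lam mS).
- by apply/(measurable_restrictT _ mI); exact: measurable_cst.
move=> y _; rewrite patchE; case: ifPn => [_|].
  apply: lebesgue_measure_diam => //; first exact: measurable_ysection.
  by move=> x z; rewrite /ysection/= !inE; exact: Sr.
rewrite notin_setE/= in_itv/= => yab.
rewrite (_ : ysection S y = set0) ?measure0// -subset0 => x.
by rewrite /ysection/= inE => /Sab.
Qed.

Definition shear k (S : set plane) : set plane :=
  [set x | S (x.1 + k * x.2, x.2)].

Lemma measurable_shear k S : measurable S -> measurable (shear k S).
Proof.
move=> mS; have mf : measurable_fun setT (fun x : plane => (x.1 + k * x.2, x.2) : plane).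
  apply: measurable_fun_pair; last exact: measurable_snd.
  apply: measurable_funD; first exact: measurable_fst.
  by apply: measurable_funM; [exact: measurable_cst|exact: measurable_snd].
by rewrite -[shear k S]setTI; exact: mf.
Qed.

(** Each horizontal section is merely translated. *)
Lemma plane_measure_shear k S : measurable S -> lam2 (shear k S) = lam2 S.
Proof.
move=> mS; have mkS := measurable_shear k mS.
rewrite !plane_measureE_ysection//; apply: eq_integral => y _.
rewrite -(lebesgue_measure_shift (k * y) (measurable_ysection y mS)).
by congr (lam _); apply/seteqP; split => x; rewrite /ysection /shear/= !inE.
Qed.

(** For [d <= 0] the square root is [0] and both sides are false, so chords of lines that miss a
    disc are covered too. *)
Lemma normr_lt_sqrt (y d : R) : (`|y| < Num.sqrt d) = (y ^+ 2 < d).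
Proof.
have [d0|d0] := ltP 0 d; first by rewrite -sqrtr_sqr ltr_sqrt.
rewrite ler0_sqrtr// ltNge normr_ge0; apply/esym/negbTE.
by rewrite -leNgt (le_trans d0) ?sqr_ge0.
Qed.

Lemma xsection_disc c t x : 0 < t -> xsection (disc c t) x =
  `]c.2 - Num.sqrt (t ^+ 2 - (x - c.1) ^+ 2), c.2 + Num.sqrt (t ^+ 2 - (x - c.1) ^+ 2)[%classic.
Proof.
move=> t0; apply/seteqP; split => y; rewrite /xsection /disc/= inE/= in_itv/=;
  by rewrite eucl_dist_lt//= -ltr_distlC distrC normr_lt_sqrt ltrBrDl.
Qed.

Lemma measure_xsection_disc c t x : 0 < t ->
  lam (xsection (disc c t) x) = (2 * Num.sqrt (t ^+ 2 - (x - c.1) ^+ 2))%:E.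
Proof.
move=> t0; rewrite xsection_disc// lebesgue_measure_itv/= lte_fin.
case: ltP => h; first by rewrite -EFinB; congr EFin; ring.
have := sqrtr_ge0 (t ^+ 2 - (x - c.1) ^+ 2); set s := Num.sqrt _ in h *.
by move=> s0; congr EFin; lra.
Qed.

Lemma measurable_disc c t : measurable (disc c t : set plane).
Proof. by apply: open_measurable2; exact: disc_open. Qed.

(** The chord lengths [G] are integrated by the substitution [F], that is [c.1 + t * sin x], for [x]
    between [- (pi / 2)] and [pi / 2]; [H] is a primitive of the resulting integrand [h]. *)
Lemma plane_measure_disc c t : 0 < t -> lam2 (disc c t) = (pi * t ^+ 2)%:E.
Proof.
move=> t0; rewrite /product_measure1.
pose G x := 2 * Num.sqrt (t ^+ 2 - (x - c.1) ^+ 2).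
pose F (x : R) := c.1 + t * sin x.
have dF (x : R) : is_derive x 1 F (t * cos x).
  by apply: is_derive_eq; rewrite /GRing.scale/= add0r mul1r.
have pi0 : 0 < pi :> R by exact: pi_gt0.
have FE : F^`()%classic = fun x => t * cos x.
  by apply/funext => x; rewrite derive1E; exact: derive_val.
have Fpi : F (pi / 2) = c.1 + t by rewrite /F sin_pihalf mulr1.
have FNpi : F (- (pi / 2)) = c.1 - t by rewrite /F sinN sin_pihalf mulrN1.
have cF : continuous F.
  by move=> x; apply: differentiable_continuous; apply/derivable1_diffP; exact: ex_derive.
have cF' : continuous (fun x : R => t * cos x).
  by move=> x; apply: cvgM; [exact: cvg_cst|exact: continuous_cos].
have cG : continuous G.
  move=> x; apply: cvgM; first exact: cvg_cst.
  apply: continuous_comp; last exact: sqrt_continuous.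
  apply: cvgB; first exact: cvg_cst.
  have cB : (y - c.1) @[y --> x] --> x - c.1 by apply: cvgB; [exact: cvg_id|exact: cvg_cst].
  exact: (cvgM cB cB).
transitivity (\int[lam]_(x in `[(F (- (pi / 2)))%R, (F (pi / 2))%R]) (G x)%:E)%E.
  rewrite Fpi FNpi [RHS]integral_mkcond; apply: eq_integral => x _.
  rewrite /= measure_xsection_disc// patchE; case: ifPn => //.
  rewrite notin_setE/= in_itv/= => /negP; rewrite -ler_distlC => h.
  have tx : t <= `|x - c.1| by rewrite distrC ltW// ltNge; exact: h.
  rewrite ler0_sqrtr ?mulr0//.
  by rewrite subr_le0 -[leRHS]real_normK ?num_real// ler_pXn2r// nnegrE// ltW.
rewrite integration_by_substitution_increasing//; last first.
- exact: continuous_subspaceT.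
- split.
  + by move=> x _; exact: ex_derive.
  + by apply: cvg_at_right_filter; exact: cF.
  + by apply: cvg_at_left_filter; exact: cF.
- by rewrite FE; apply/cvg_ex; eexists; apply: cvg_at_left_filter; exact: cF'.
- by rewrite FE; apply/cvg_ex; eexists; apply: cvg_at_right_filter; exact: cF'.
- by rewrite FE => x _; exact: cF'.
- by move=> x y xI yI xy; rewrite /F ltrD2l ltr_pM2l// ltr_sin.
- by lra.
pose H (x : R) := t ^+ 2 * (x + sin x * cos x).
pose h (x : R) := 2 * t ^+ 2 * cos x ^+ 2.
have dH (x : R) : is_derive x 1 H (h x).
  apply: is_derive_eq; rewrite /GRing.scale/=.
  by rewrite mulrN -!expr2 sin2cos2 /h; ring.
have cH : continuous H.
  by move=> x; apply: differentiable_continuous; apply/derivable1_diffP; exact: ex_derive.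
have ch : continuous h.
  move=> x; apply: cvgM; first exact: cvg_cst.
  by have cx := @continuous_cos R x; exact: (cvgM cx cx).
rewrite (_ : integral _ _ _ =
    \int[lam]_(x in `[(- (pi / 2))%R, (pi / 2)%R]) (h x)%:E)%E; last first.
  apply: eq_integral => x; rewrite inE/= in_itv/= => xI; congr EFin.
  rewrite FE (_ : (_ * _) x = G (F x) * (t * cos x))//.
  have -> : G (F x) = 2 * (t * cos x).
    rewrite /G /F (_ : t ^+ 2 - _ = (t * cos x) ^+ 2); last by rewrite !exprMn cos2sin2; ring.
    by rewrite sqrtr_sqr ger0_norm// mulr_ge0 ?cos_ge0_pihalf// ltW.
  by rewrite /h; ring.
rewrite (@continuous_FTC2 _ h H); last first.
- by move=> x _; rewrite derive1E; exact: derive_val.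
- split.
  + by move=> x _; exact: ex_derive.
  + by apply: cvg_at_right_filter; exact: cH.
  + by apply: cvg_at_left_filter; exact: cH.
- exact: continuous_subspaceT.
- by lra.
rewrite -EFinB /H sinN cosN cos_pihalf; congr EFin; by field.
Qed.

(** Convexity of a squared distance along a line: the defect in the convexity inequality is
    [(k^2 + l^2) (u - s) (m - s) (u - m)]. *)
Lemma quadratic_between (a b k l s u m T : R) : s <= m -> m <= u ->
  (a + k * s) ^+ 2 + (b + l * s) ^+ 2 < T ->
  (a + k * u) ^+ 2 + (b + l * u) ^+ 2 < T ->
  (a + k * m) ^+ 2 + (b + l * m) ^+ 2 < T.
Proof.
move=> sm mu hs hu; have [su|us] := ltP s u; last first.
  by have -> : m = s by lra.
rewrite -(ltr_pM2l (x := u - s)) ?subr_gt0//.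
have := mulr_ge0 (addr_ge0 (sqr_ge0 k) (sqr_ge0 l)) (mulr_ge0 (_ : 0 <= m - s) (_ : 0 <= u - m)).
rewrite !subr_ge0 => /(_ sm mu) /(mulr_ge0 (_ : 0 <= u - s)) h.
apply: (@le_lt_trans _ _ ((u - m) * ((a + k * s) ^+ 2 + (b + l * s) ^+ 2)
    + (m - s) * ((a + k * u) ^+ 2 + (b + l * u) ^+ 2))).
  rewrite -subr_ge0; apply: le_trans (h _) _; first by rewrite subr_ge0 ltW.
  by rewrite le_eqVlt; apply/orP; left; apply/eqP; ring.
rewrite (_ : (u - s) * T = (u - m) * T + (m - s) * T); last by ring.
have [um|mu'] := ltP m u.
  by apply: ltr_leD; [rewrite ltr_pM2l// subr_gt0|rewrite ler_wpM2l ?subr_ge0// ltW].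
have -> : m = u by lra.
by rewrite subrr !mul0r !add0r ltr_pM2l// subr_gt0.
Qed.

(** By convexity [Q < T] cuts out an interval; if [s] exceeded [u + |v|], then [s - v] or [u - v],
    according to the sign of [v], would lie between [u] and [s], hence in that interval. This bounds
    the sections, parallel to the translation, of a disc minus its translate. *)
Lemma quadratic_shift_diam (a b k l v T s u : R) :
  let Q := fun x => (a + k * x) ^+ 2 + (b + l * x) ^+ 2 in
  Q s < T -> T <= Q (s - v) -> Q u < T -> T <= Q (u - v) -> s <= u + `|v|.
Proof.
move=> Q Qs Qsv Qu Quv; rewrite leNgt; apply/negP => us.
have vv : v <= `|v| by exact: ler_norm.
have vN : - v <= `|v| by rewrite -normrN; exact: ler_norm.
have [v0|v0] := leP 0 v.
  have : Q (s - v) < T by apply: (@quadratic_between _ _ _ _ u s); rewrite //; lra.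
  by rewrite ltNge Qsv.
have : Q (u - v) < T by apply: (@quadratic_between _ _ _ _ u s); rewrite //; lra.
by rewrite ltNge Quv.
Qed.

(* Shearing makes [q - p] parallel to the second axis; the sheared disc then
   projects to the first axis onto an interval whose length times the height
   of [q - p] is again [2 * t * eucl_dist p q]. *)
Lemma plane_measure_disc_diff p q t : 0 < t ->
  (lam2 (disc p t `\` disc q t) <= (2 * t * eucl_dist p q)%:E)%E.
Proof.
move=> t0; set S := disc p t `\` disc q t.
have mS : measurable (S : set plane) by apply: measurableD; exact: measurable_disc.
have inS (x y : R) : S (x, y) <->
    (x - p.1) ^+ 2 + (y - p.2) ^+ 2 < t ^+ 2 /\ t ^+ 2 <= (x - q.1) ^+ 2 + (y - q.2) ^+ 2.
  by rewrite /S /disc/= !eucl_dist_lt//= leNgt; split => -[-> /negP].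
(* A horizontal translation cannot be sheared to a vertical one; here horizontal sections are used
   directly. *)
have [pq|pq] := eqVneq q.2 p.2.
  have -> : 2 * t * eucl_dist p q = ((p.2 + t) - (p.2 - t)) * `|q.1 - p.1|.
    rewrite /eucl_dist pq subrr (expr0n _ 2) addr0 sqrtr_sqr distrC.
    by congr (_ * _); ring.
  apply: plane_measure_ystrip => //; first by lra.
    move=> [x y] /= /inS[h _]; rewrite -ler_distlC; apply: ler_of_sqr; first exact: ltW.
    rewrite real_normK ?num_real//; have := sqr_ge0 (x - p.1); rewrite -sqrrN opprB; lra.
  move=> x y z /inS[h1 h2] /inS[h3 h4].
  rewrite pq in h2 h4.
  by apply: (@quadratic_shift_diam (- p.1) (z - p.2) 1 0 _ (t ^+ 2)); rewrite /=; nra.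
pose v := q.2 - p.2; have v0 : v != 0 by rewrite subr_eq0.
pose k := (q.1 - p.1) / v.
have kv : q.1 - p.1 = k * v by rewrite /k divfK.
(* [w] is the half-width of the projection of the sheared disc, by Cauchy-Schwarz applied to
   [(1, - k)]; the square added below is the complementary one in Lagrange's identity. *)
rewrite -(plane_measure_shear k mS); pose w := t * Num.sqrt (1 + k ^+ 2).
have w0 : 0 <= w by rewrite mulr_ge0 ?sqrtr_ge0// ltW.
have -> : 2 * t * eucl_dist p q = ((p.1 - k * p.2 + w) - (p.1 - k * p.2 - w)) * `|v|.
  rewrite (_ : _ - _ = 2 * w); last by ring.
  rewrite /w -!mulrA -(sqrtr_sqr v) -sqrtrM; last by rewrite addr_ge0// sqr_ge0.
  rewrite eucl_distC /eucl_dist kv -/v; congr (_ * (_ * Num.sqrt _)); ring.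
apply: plane_measure_xstrip => //; first by lra.
- exact: measurable_shear.
- move=> [x y] /= /inS[h _]; rewrite -ler_distlC; apply: ler_of_sqr; first exact: w0.
  rewrite real_normK ?num_real// /w exprMn sqr_sqrtr; last by rewrite addr_ge0// sqr_ge0.
  have := sqr_ge0 (k * (x + k * y - p.1) + (y - p.2)).
  have : 0 <= (1 + k ^+ 2) * (t ^+ 2 - ((x + k * y - p.1) ^+ 2 + (y - p.2) ^+ 2)).
    by apply: mulr_ge0; [rewrite addr_ge0// sqr_ge0|rewrite subr_ge0 ltW].
  by nra.
- move=> x y z /inS[h1 h2] /inS[h3 h4].
  have q1E : q.1 = k * v + p.1 by rewrite -kv; ring.
  have E u : u - q.2 = u - v - p.2 by rewrite /v; ring.
  have E' u : x + k * u - q.1 = x + k * (u - v) - p.1.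
    by rewrite q1E; ring.
  apply: (@quadratic_shift_diam (x - p.1) (- p.2) k 1 _ (t ^+ 2)); rewrite /=;
    move: h1 h2 h3 h4; rewrite /= !(E, E'); lra.
Qed.
End plane_measure.

(** * The Brunn-Minkowski inequality with a disc *)

Section brunn_minkowski.
Context {R : realType}.
Local Notation lam := (@lebesgue_measure R).
Local Notation lam2 := (@lebesgue_measure R \x @lebesgue_measure R)%E.
Local Notation plane := (measurableTypeR R * measurableTypeR R)%type.
Implicit Types (f : measurableTypeR R -> \bar R) (D : set (R * R)) (x y r t s : R).

Lemma measurable_subgraph f : measurable_fun setT f ->
  measurable [set xs : plane | (xs.2%:E < f xs.1)%E].
Proof.
move=> mf; rewrite -[X in measurable X]setTI.
apply: emeasurable_fun_lt => //.
  by apply/measurable_EFinP; exact: measurable_snd.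
exact: (measurableT_comp mf measurable_fst).
Qed.

Lemma measurable_superlevel f : measurable_fun setT f ->
  measurable_fun setT (fun s => lam [set x | (s%:E < f x)%E]).
Proof.
move=> /measurable_subgraph/(measurable_fun_ysection lam); apply: eq_measurable_fun.
by move=> s _; congr (lam _); apply/seteqP; split => x; rewrite /ysection/= inE.
Qed.

(** Both sides are the area of the region [A] under the graph, sliced vertically and
    horizontally. *)
Lemma layer_cake f : measurable_fun setT f -> (forall x, 0 <= f x)%E ->
  (\int[lam]_x f x = \int[lam]_(s in `[0%R, +oo[) lam [set x | (s%:E < f x)%E])%E.
Proof.
move=> mf f0.
pose A : set plane := [set xs : plane | (xs.2%:E < f xs.1)%E] `&` (setT `*` `[0%R, +oo[).
have mA : measurable A.
  apply: measurableI; first exact: measurable_subgraph.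
  by apply: measurableX => //; exact: measurable_itv.
transitivity (lam2 A).
  apply: eq_integral => x _ /=.
  have -> : xsection A x = [set s | (0 <= s)%R /\ (s%:E < f x)%E].
    apply/seteqP; split => s; rewrite /xsection/= inE /A/= in_itv/= andbT.
      by case=> ? [].
    by case=> ? ?.
  case: (f x) (f0 x) => [v|_|//].
    rewrite lee_fin => v0.
    have -> : [set s | 0 <= s /\ (s%:E < v%:E)%E] = `[0, v[%classic.
      by apply/seteqP; split => s /=; rewrite in_itv/= lte_fin => /andP.
    rewrite lebesgue_measure_itv/= lte_fin; case: ltP => [_|v0'].
      by rewrite oppr0 adde0.
    by congr EFin; apply/eqP; rewrite eq_le v0 v0'.
  have -> : [set s : R | 0 <= s /\ (s%:E < +oo)%E] = `[0, +oo[%classic.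
    apply/seteqP; split => s /=; rewrite in_itv/= ltry andbT; first by case.
    by [].
  by rewrite lebesgue_measure_itv/= ltry.
rewrite plane_measureE_ysection// [RHS]integral_mkcond; apply: eq_integral => s _ /=.
rewrite patchE; case: ifPn => [|].
  rewrite inE/= in_itv/= andbT => s0; congr (lam _).
  apply/seteqP; split => x; rewrite /ysection/= inE /A/= in_itv/= andbT.
    by case.
  by [].
rewrite notin_setE/= in_itv/= andbT => s0; rewrite -[RHS](measure0 lam); congr (lam _).
rewrite -subset0 => x; rewrite /ysection/= inE /A/= in_itv/= andbT.
by case=> _ [].
Qed.

Definition neighborhood D t : set (R * R) := \bigcup_(d in D) disc d t.

Lemma neighborhood_open D t : open (neighborhood D t).
Proof. by apply: bigcup_open => d _; exact: disc_open. Qed.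

Lemma bounded_planeP D : bounded_set D ->
  exists M : R, forall p, D p -> `|p.1| <= M /\ `|p.2| <= M.
Proof.
case=> M [_ DM]; exists (M + 1) => x Dx.
have /DM/(_ x Dx) : M < M + 1 by rewrite ltrDl.
by rewrite /= prod_normE ge_max => /andP[].
Qed.

(** The section of the neighbourhood at [x + y] contains the section of [D] at [x] thickened by half
    the chord of the disc at [y]. *)
Lemma xsection_neighborhood D t x y : open D -> bounded_set D -> 0 < t ->
  xsection D x !=set0 -> `|y| < t ->
  (lam (xsection D x) + lam (xsection (disc (0, 0)%R t) y) <=
   lam (xsection (neighborhood D t) (x + y)%R))%E.
Proof.
move=> oD /bounded_planeP[M DM] t0 D0 yt.
rewrite measure_xsection_disc//= subr0; apply: lebesgue_measure_thicken => //.
- rewrite sqrtr_gt0 subr_gt0 -[ltLHS]real_normK ?num_real//.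
  by rewrite ltr_pXn2r// nnegrE// ltW.
- by apply: measurable_xsection; exact: open_measurable2.
- by apply: measurable_xsection; apply: open_measurable2; exact: neighborhood_open.
- by exists M => u; rewrite /xsection/= inE => /DM[_]; rewrite ler_norml => /andP[].
- exists (- M) => u; rewrite /xsection/= inE => /DM[_].
  by rewrite ler_norml => /andP[].
- move=> u v; rewrite /xsection/= !inE => Dxu; rewrite normr_lt_sqrt => uv.
  exists (x, u) => //; rewrite /disc/= eucl_dist_lt//= (addrC x) addrK.
  by rewrite addrC -ltrBrDr.
Qed.

(** The section lengths [f], [g], [h] of [D], the disc and the neighbourhood are compared at
    proportional heights [F s], [2 t s] and [(F + 2 t) s]: the sum of the first two superlevel sets
    lies in the third. The one-dimensional inequality is applied for each [s] and integrated by
    [layer_cake]. *)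
Lemma brunn_minkowski_disc D t r : open D -> bounded_set D -> 0 < t -> 0 < r ->
  lam2 D = (pi * r ^+ 2)%:E ->
  ((pi * (r + t) ^+ 2)%:E <= lam2 (neighborhood D t))%E.
Proof.
move=> oD bD t0 r0 DA; have pi0 : 0 < pi :> R by exact: pi_gt0.
have [M DM] := bounded_planeP bD.
have mD : measurable (D : set plane) by exact: open_measurable2.
have mN : measurable (neighborhood D t : set plane).
  by apply: open_measurable2; exact: neighborhood_open.
pose f x := lam (xsection D x); pose g y := lam (xsection (disc (0, 0)%R t : set plane) y).
pose h z := lam (xsection (neighborhood D t) z).
have mf : measurable_fun setT f by exact: (measurable_fun_xsection lam mD).
have mg : measurable_fun setT g by exact: (measurable_fun_xsection lam (measurable_disc _ _)).
have mh : measurable_fun setT h by exact: (measurable_fun_xsection lam mN).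
have fM x : (f x <= (2 * `|M|)%:E)%E.
  apply: (@le_trans _ _ (lam `[- M, M]%classic)).
    apply: (le_measure lam (mem_set (measurable_xsection _ mD)) (mem_set (measurable_itv _))).
    move=> y; rewrite /xsection/= inE => /DM[_].
    by rewrite in_itv/= ler_norml.
  rewrite lebesgue_measure_itv/=; case: ifP => _; last by rewrite lee_fin mulr_ge0.
  by rewrite -EFinB lee_fin; have := ler_norm M; lra.
have fE x : f x = (fine (f x))%:E.
  by rewrite fineK// ge0_fin_numE ?measure_ge0// (le_lt_trans (fM x)) ?ltry.
(* [F] is the supremum of [f], as [2 t] is that of [g]; this keeps the superlevel sets non-empty for
   [s < 1], as [lebesgue_measure_thicken] demands. *)
have [F [F0 fF Fsup]] : exists F : R, [/\ 0 < F, forall x, (f x <= F%:E)%E &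
    forall u : R, u < F -> exists x, (u%:E < f x)%E].
  have ubf : has_ubound (range (fine \o f)).
    exists (2 * `|M|) => _ [x _ <-] /=; rewrite -lee_fin -fE; exact: fM.
  have f0 : range (fine \o f) !=set0 by exists (fine (f 0)); exists 0.
  exists (sup (range (fine \o f))); split.
  - rewrite ltNge; apply/negP => F0.
    have : lam2 D = 0%E.
      rewrite /product_measure1 integral0_eq// => x _ /=.
      apply/eqP; rewrite eq_le measure_ge0 andbT -/(f x) fE lee_fin.
      by apply: le_trans F0; apply: ub_le_sup => //; exists x.
    rewrite DA => -[/eqP]; apply/negP.
    by rewrite mulf_neq0 ?sqrf_eq0 ?gt_eqF.
  - by move=> x; rewrite fE lee_fin; apply: ub_le_sup => //; exists x.
  - move=> u uF; have [_ [x _ <-] ux] := sup_gt f0 uF.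
    by exists x; rewrite fE lte_fin.
pose scale k (u : measurableTypeR R -> \bar R) x := (k^-1%:E * u x)%E.
have scale_layer (k : R) (u : measurableTypeR R -> \bar R) : 0 < k ->
    measurable_fun setT u -> (forall x, 0 <= u x)%E ->
    (\int[lam]_(s in `[0%R, +oo[) lam [set x | (s%:E < scale k u x)%E] =
     k^-1%:E * \int[lam]_x u x)%E.
  move=> k0 mu u0; rewrite -layer_cake; last 2 first.
  - exact: measurable_funeM.
  - by move=> x; rewrite mule_ge0// lee_fin invr_ge0 ltW.
  by rewrite ge0_integralZl// lee_fin invr_ge0 ltW.
have mscale (k : R) (u : measurableTypeR R -> \bar R) : measurable_fun setT u ->
    measurable_fun (`[0%R, +oo[%classic : set (measurableTypeR R))
      (fun s : R => lam [set x | (s%:E < scale k u x)%E]).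
  move=> mu; apply: measurable_funTS; apply: measurable_superlevel.
  exact: measurable_funeM.
have lt_scale (k : R) (u : measurableTypeR R -> \bar R) s x : 0 < k ->
    (s%:E < scale k u x)%E = ((k * s)%:E < u x)%E.
  by move=> k0; rewrite /scale lte_pdivlMl.
have mI : measurable (`[0, +oo[%classic : set (measurableTypeR R)) by exact: measurable_itv.
have t20 : 0 < 2 * t by rewrite mulr_gt0.
have Ft0 : 0 < F + 2 * t by rewrite addr_gt0.
have key : (F^-1%:E * (pi * r ^+ 2)%:E + (2 * t)^-1%:E * (pi * t ^+ 2)%:E <=
    (F + 2 * t)^-1%:E * lam2 (neighborhood D t))%E.
  rewrite -DA -(plane_measure_disc (0, 0)%R t0) -!scale_layer//.
  rewrite -ge0_integralD//; [|exact: mscale..].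
  rewrite -[lam \o xsection D]/f -[lam \o xsection (disc _ t)]/g.
  rewrite -[lam \o xsection (neighborhood D t)]/h.
  apply: ge0_le_integral => //.
  - by move=> s _; rewrite adde_ge0.
  - by apply: emeasurable_funD; exact: mscale.
  - exact: mscale.
  rewrite /= => s; rewrite in_itv/= andbT => s0.
  have setE (k : R) (u : measurableTypeR R -> \bar R) : 0 < k ->
      [set x | (s%:E < scale k u x)%E] = [set x | ((k * s)%:E < u x)%E].
    by move=> k0; apply/seteqP; split => x /=; rewrite lt_scale.
  have gE y : g y = (2 * Num.sqrt (t ^+ 2 - y ^+ 2))%:E.
    by rewrite /g measure_xsection_disc//= subr0.
  rewrite !setE//.
  (* From height [1] on, both sets on the left are empty. *)
  have [s1|s1] := leP 1 s.
    have -> : [set x | ((F * s)%:E < f x)%E] = set0.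
      rewrite -subset0 => x /=; apply/negP; rewrite -leNgt (le_trans (fF x))// lee_fin.
      by rewrite ler_peMr// ltW.
    have -> : [set x | ((2 * t * s)%:E < g x)%E] = set0.
      rewrite -subset0 => x /=; apply/negP; rewrite -leNgt gE lee_fin -mulrA.
      rewrite ler_pM2l// (@le_trans _ _ t)//; last by rewrite ler_peMr// ltW.
      rewrite -[leRHS](ger0_norm (ltW t0)) -sqrtr_sqr ler_wsqrtr//.
      by rewrite lerBlDr lerDl sqr_ge0.
    by rewrite measure0 add0e.
  set rho := Num.sqrt (t ^+ 2 - (t * s) ^+ 2).
  have ts : t * s < t by rewrite gtr_pMr.
  have rho0 : 0 < rho.
    by rewrite sqrtr_gt0 subr_gt0 ltr_pXn2r// nnegrE ?mulr_ge0// ltW.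
  have g_lt y : (((2 * t * s)%:E < g y)%E) = (`|y| < rho).
    rewrite gE lte_fin -mulrA ltr_pM2l// -[t * s]ger0_norm; last by rewrite mulr_ge0// ltW.
    by rewrite !normr_lt_sqrt ltrBrDl -ltrBrDr.
  have -> : [set x | ((2 * t * s)%:E < g x)%E] = `]- rho, rho[%classic.
    by apply/seteqP; split => y /=; rewrite g_lt in_itv/= ltr_norml.
  have -> : lam `]- rho, rho[%classic = (2 * rho)%:E.
    rewrite lebesgue_measure_itv/= lte_fin ifT; last by rewrite (@lt_trans _ _ 0)// oppr_lt0.
    by rewrite -EFinB; congr EFin; ring.
  have mX (u : measurableTypeR R -> \bar R) (k : R) : measurable_fun setT u ->
      measurable [set x | (k%:E < u x)%E].
    by move=> mu; rewrite -[X in measurable X]setTI; exact: emeasurable_fun_o_infty.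
  have fX x : ((F * s)%:E < f x)%E -> xsection D x !=set0.
    move=> fx; apply/set0P/negP => /eqP D0; move: fx; rewrite /f D0 measure0 lte_fin.
    by rewrite ltNge mulr_ge0// ltW.
  have fM' x : ((F * s)%:E < f x)%E -> `|x| <= M.
    by move=> /fX[y]; rewrite /xsection/= inE => /DM[].
  apply: lebesgue_measure_thicken => //.
  - exact: mX.
  - exact: mX.
  - by apply: Fsup; rewrite gtr_pMr.
  - by exists M => x /= /fM'; rewrite ler_norml => /andP[].
  - by exists (- M) => x /= /fM'; rewrite ler_norml => /andP[].
  - move=> x z /= fx zx.
    have zt : `|z - x| < t.
      apply: (lt_le_trans zx); rewrite -[leRHS](ger0_norm (ltW t0)) -sqrtr_sqr ler_wsqrtr//.
      by rewrite lerBlDr lerDl sqr_ge0.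
    have := xsection_neighborhood oD bD t0 (fX _ fx) zt.
    rewrite (addrC x (z - x)) subrK -/(f x) -/(g (z - x)) -/(h z); apply: lt_le_trans.
    by rewrite mulrDl EFinD lteD// g_lt.
have {key} : (((F + 2 * t) * (F^-1 * (pi * r ^+ 2) + (2 * t)^-1 * (pi * t ^+ 2)))%:E <=
    lam2 (neighborhood D t))%E.
  by rewrite EFinM -lee_pdivlMl ?addr_gt0 ?mulr_gt0// EFinD !EFinM.
apply: le_trans; rewrite lee_fin -subr_ge0.
(* The arithmetic-geometric inequality [2 r^2 / F + F / 2 >= 2 r] in the form of a square. *)
rewrite (_ : _ - _ = pi * t / (2 * F) * (2 * r - F) ^+ 2); last by field; rewrite ?gt_eqF.
by rewrite mulr_ge0 ?sqr_ge0// divr_ge0 ?mulr_ge0// ltW.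
Qed.

End brunn_minkowski.

(** * Discs straddled by a curve *)

Section straddling_discs.
Context {R : realType}.
Local Notation lam2 := (@lebesgue_measure R \x @lebesgue_measure R)%E.
Local Notation plane := (measurableTypeR R * measurableTypeR R)%type.
Implicit Types (p : nat -> R * R) (a b t L : R) (g : R -> R * R).

(** Truth propagates from [i] up to [n], wraps around to [0], and then reaches [j]. *)
Lemma bool_cycle_exit (u : nat -> bool) n :
  u 0 = u n -> (forall i, (i < n)%N -> u i -> u i.+1) ->
  forall i j, (i <= n)%N -> (j <= n)%N -> u i -> u j.
Proof.
move=> u0n uS i j.
have mono k m : (k <= m)%N -> (m <= n)%N -> u k -> u m.
  elim: m => [|m IH]; first by rewrite leqn0 => /eqP ->.
  rewrite leq_eqVlt => /predU1P[-> //|km] mn uk.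
  by apply: uS => //; apply: IH => //; exact: ltnW.
move=> ni nj ui; apply: (mono 0) => //; rewrite u0n.
exact: (mono i).
Qed.

(** Around the closed polygon, being within [t] of [x] must be lost along some edge, so the sets
    [F i] cover [E]. *)
Lemma measure_discs_straddling_polygon p n t : 0 < t -> p 0 = p n ->
  (lam2 ((\bigcup_(i in [set i | (i <= n)%N]) disc (p i) t) `&`
         (\bigcup_(i in [set i | (i <= n)%N]) ~` disc (p i) t)) <=
   (2 * t * \sum_(0 <= i < n) eucl_dist (p i) (p i.+1))%:E)%E.
Proof.
move=> t0 p0n; set E := _ `&` _.
have mE : measurable (E : set plane).
  apply: measurableI; apply: bigcup_measurable => i _.
    exact: measurable_disc.
  by apply: measurableC; exact: measurable_disc.
pose F i : set plane := disc (p i) t `\` disc (p i.+1) t.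
have mF i : measurable (F i) by apply: measurableD; exact: measurable_disc.
have EF : E `<=` \big[setU/set0]_(i < n) F i.
  rewrite -bigcup_mkord => x [[i /= iN xi] [j /= jN xj]].
  apply: contrapT => nF; apply: xj.
  pose u k := eucl_dist x (p k) < t.
  apply: (@bool_cycle_exit u n _ _ i j) => //; first by rewrite /u p0n.
  move=> k kn uk; rewrite /u; apply: contrapT => uk1; apply: nF.
  by exists k.
apply: (le_trans (content_subadditive lam2 (fun k _ => mF k) mE EF)).
rewrite big_mkord mulr_sumr -sumEFin; apply: lee_sum => i _.
exact: plane_measure_disc_diff.
Qed.

(** Subdivisions into [2 ^ k] equal parts are nested, which makes the approximating sets in
    [measure_straddling] increase with [k]. *)
Definition dyadic a b (k i : nat) : R := a + (b - a) * (i%:R / (2 ^ k)%:R).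

Lemma dyadic_le a b k i : a < b -> (i <= 2 ^ k)%N -> a <= dyadic a b k i <= b.
Proof.
move=> ab ik; have k0 : 0 < (2 ^ k)%:R :> R by rewrite ltr0n expn_gt0.
have h0 : 0 <= i%:R / (2 ^ k)%:R :> R by rewrite divr_ge0.
have h1 : i%:R / (2 ^ k)%:R <= 1 :> R by rewrite ler_pdivrMr// mul1r ler_nat.
by rewrite /dyadic; apply/andP; split; nra.
Qed.

Lemma dyadicS a b k i : dyadic a b k.+1 i.*2 = dyadic a b k i.
Proof.
rewrite /dyadic -mul2n expnS !natrM; congr (_ + _ * _).
by rewrite -mulf_div divff ?pnatr_eq0// mul1r.
Qed.

Lemma dyadic_dense a b s e : a < b -> a <= s <= b -> 0 < e ->
  exists k0, forall k, (k0 <= k)%N -> exists2 i, (i <= 2 ^ k)%N & `|dyadic a b k i - s| < e.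
Proof.
move=> ab /andP[as_ sb] e0; have ba : 0 < b - a by rewrite subr_gt0.
(* [2 ^ k > k >= N > (b - a) / e] makes the mesh smaller than [e]. *)
pose N := (Num.trunc ((b - a) / e)).+1.
exists N => k Nk; have k0 : 0 < (2 ^ k)%:R :> R by rewrite ltr0n expn_gt0.
pose v := (s - a) / (b - a) * (2 ^ k)%:R.
have v0 : 0 <= v by rewrite mulr_ge0 ?divr_ge0// ?subr_ge0// ltW.
have /andP[iv vi] := truncn_itv v0; set i := Num.trunc v in iv vi.
have v1 : v <= (2 ^ k)%:R.
  by rewrite /v -[leRHS]mul1r ler_pM2r// ler_pdivrMr// mul1r lerD2r.
exists i; first by rewrite -(ler_nat R) (le_trans iv).
have sE : s = a + (b - a) * (v / (2 ^ k)%:R).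
  by rewrite /v; field; rewrite !gt_eqF.
rewrite /dyadic {1}sE opprD addrACA subrr add0r -mulrBr -mulrBl normrM gtr0_norm//.
rewrite mulrC -ltr_pdivlMr// normrM [X in _ * X]gtr0_norm ?invr_gt0//.
rewrite ltr_pdivrMr// (@lt_le_trans _ _ 1)//; first by rewrite ltr_norml; lra.
rewrite -ler_pdivrMl ?divr_gt0// mulr1 invf_div.
have /andP[_ h] : (Num.trunc ((b - a) / e))%:R <= (b - a) / e < N%:R.
  by apply: truncn_itv; rewrite divr_ge0// ltW.
apply: ltW; apply: (lt_le_trans h); rewrite ler_nat (leq_trans Nk)//.
by apply: ltnW; exact: ltn_expl.
Qed.

Lemma dyadic_partition a b k : a < b ->
  itv_partition a b (mkseq (fun i => dyadic a b k i.+1) (2 ^ k)).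
Proof.
move=> ab; have k0 : (0 < 2 ^ k)%N by rewrite expn_gt0.
split.
  apply/(pathP a) => i; rewrite size_mkseq => ik; rewrite nth_mkseq//.
  have -> : nth a (a :: mkseq (fun i => dyadic a b k i.+1) (2 ^ k)) i = dyadic a b k i.
    case: i ik => [_|i ik] /=; first by rewrite /dyadic mul0r mulr0 addr0.
    by rewrite nth_mkseq// ltnW.
  rewrite /dyadic ltrD2l ltr_pM2l ?subr_gt0// ltr_pM2r ?invr_gt0 ?ltr0n//.
  by rewrite ltr_nat.
rewrite (last_nth a) size_mkseq -(prednK k0) /= nth_mkseq// ?prednK//.
by rewrite /dyadic divff ?mulr1 ?pnatr_eq0 -?lt0n// addrC subrK.
Qed.

Lemma polygonal_length_dyadic a b g k :
  polygonal_length a g (mkseq (fun i => dyadic a b k i.+1) (2 ^ k)) =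
  \sum_(0 <= i < 2 ^ k) eucl_dist (g (dyadic a b k i)) (g (dyadic a b k i.+1)).
Proof.
rewrite /polygonal_length size_mkseq; apply: eq_big_nat => i /= ik.
congr (eucl_dist (g _) (g _)); last by rewrite nth_mkseq.
case: i ik => [_|i ik] /=; first by rewrite /dyadic mul0r mulr0 addr0.
by rewrite nth_mkseq// ltnW.
Qed.

Lemma within_itv_near a b g s (O : set (R * R)) : {within `[a, b], continuous g} ->
  a <= s <= b -> nbhs (g s) O ->
  exists2 e, 0 < e & forall u, a <= u <= b -> `|u - s| < e -> O (g u).
Proof.
move=> /subspace_continuousP cg sab Os.
have /= := cg s; rewrite in_itv/= => /(_ sab O Os).
rewrite /nbhs/= /within/= => /nbhs_ballP[e /= e0 eO]; exists e => // u uab us.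
by apply: eO; rewrite /ball/= ?in_itv// distrC.
Qed.

(** Both inequalities are strict: the set is open, and the two points of the curve may be replaced
    by nearby dyadic ones. *)
Definition straddling a b g t : set (R * R) :=
  (\bigcup_(s in `[a, b]) disc (g s) t) `&`
  (\bigcup_(s in `[a, b]) [set x | t < eucl_dist x (g s)]).

Lemma straddling_open a b g t : open (straddling a b g t).
Proof.
apply: openI; apply: bigcup_open => s _; first exact: disc_open.
exact: open_outside_disc.
Qed.

(* A disc which a closed curve both enters and leaves is left along one of the
   edges of any fine enough inscribed polygon, and the centres of the discs
   left along an edge of length [l] have measure at most [2 * t * l]. *)
Lemma measure_straddling a b g t L : a < b -> {within `[a, b], continuous g} ->
  g a = g b -> curve_length a b g = L%:E -> 0 < t ->
  (lam2 (straddling a b g t) <= (2 * t * L)%:E)%E.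
Proof.
move=> ab cg gab gL t0.
pose E k : set plane :=
  (\bigcup_(i in [set i | (i <= 2 ^ k)%N]) disc (g (dyadic a b k i)) t) `&`
  (\bigcup_(i in [set i | (i <= 2 ^ k)%N]) ~` disc (g (dyadic a b k i)) t).
have mE k : measurable (E k).
  apply: measurableI; apply: bigcup_measurable => i _.
    exact: measurable_disc.
  by apply: measurableC; exact: measurable_disc.
have mUE : measurable (\bigcup_k E k) by apply: bigcup_measurable => k _.
have EL k : (lam2 (E k) <= (2 * t * L)%:E)%E.
  apply: (le_trans (measure_discs_straddling_polygon (p := g \o dyadic a b k) (n := 2 ^ k) t0 _)).
    rewrite /= /dyadic divff ?pnatr_eq0 -?lt0n ?expn_gt0// mul0r mulr0 mulr1 addr0.
    by rewrite (addrC a) subrK.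
  rewrite lee_fin ler_pM2l ?mulr_gt0// -lee_fin -gL -polygonal_length_dyadic.
  by apply: ereal_sup_ubound; eexists; first exact: (dyadic_partition k ab).
have ndE : {homo E : n m / (n <= m)%N >-> (n <= m)%O}.
  apply: homo_leq => [//|? ? ?|k]; first exact: le_trans.
  apply/subsetPset => x [[i /= ik xi] [j /= jk xj]].
  by split; [exists i.*2|exists j.*2]; rewrite /= ?dyadicS// -mul2n expnS leq_mul2l.
have UE : straddling a b g t `<=` \bigcup_k E k.
  move=> x [[s1 /=]]; rewrite in_itv/= => s1ab xs1 [s2 /=]; rewrite in_itv/= => s2ab xs2.
  have xs1' : disc x t (g s1) by rewrite /disc/= eucl_distC.
  have xs2' : [set y | t < eucl_dist y x] (g s2) by rewrite /= eucl_distC.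
  have [e1 e10 H1] := within_itv_near cg s1ab (open_nbhs_nbhs (conj (@disc_open _ x t) xs1')).
  have [e2 e20 H2] := within_itv_near cg s2ab
    (open_nbhs_nbhs (conj (@open_outside_disc _ x t) xs2')).
  have [k1 K1] := dyadic_dense ab s1ab e10.
  have [k2 K2] := dyadic_dense ab s2ab e20.
  have [i ik di] := K1 (maxn k1 k2) (leq_maxl _ _).
  have [j jk dj] := K2 (maxn k1 k2) (leq_maxr _ _).
  exists (maxn k1 k2) => //; split.
    exists i => //; rewrite /disc/= eucl_distC.
    by apply: H1 => //; exact: dyadic_le.
  exists j => //; apply/negP; rewrite -leNgt ltW// eucl_distC.
  by apply: H2 => //; exact: dyadic_le.
apply: (@le_trans _ _ (lam2 (\bigcup_k E k))).
  by apply: le_measure; rewrite ?inE//; apply: open_measurable2; exact: straddling_open.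
have := nondecreasing_cvg_mu (mu := lam2) mE mUE ndE.
move=> cE; rewrite -(cvg_lim _ cE)//; apply: lime_le; first by apply/cvg_ex; eexists; exact: cE.
by apply: nearW => k; exact: EL.
Qed.

End straddling_discs.

(** * Components of the complement of a closed set *)

Section lines.
Context {R : realType}.
Implicit Types (c d y z : R * R) (s u t : R).

Definition line y z s : R * R := (y.1 + s * (z.1 - y.1), y.2 + s * (z.2 - y.2)).

Lemma line0 y z : line y z 0 = y.
Proof. by case: y => y1 y2; rewrite /line !mul0r !addr0. Qed.

Lemma line1 y z : line y z 1 = z.
Proof. by case: z => z1 z2; rewrite /line !mul1r /= !(addrC _ (_ - _)) !subrK. Qed.

Lemma line_continuous y z : continuous (line y z).
Proof.
move=> s; have h (p q : R) : (p + u * q) @[u --> s] --> p + s * q.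
  apply: cvgD; first exact: cvg_cst.
  by apply: cvgM; [exact: cvg_id|exact: cvg_cst].
exact: cvg_pair (h _ _) (h _ _).
Qed.

Lemma eucl_dist_line y z s u :
  eucl_dist (line y z s) (line y z u) = `|s - u| * eucl_dist y z.
Proof.
rewrite /eucl_dist/= -sqrtr_sqr -sqrtrM ?sqr_ge0//; congr Num.sqrt; ring.
Qed.

Lemma eucl_dist_line0 y z s : eucl_dist (line y z s) y = `|s| * eucl_dist y z.
Proof. by rewrite -{2}(line0 y z) eucl_dist_line subr0. Qed.

Lemma eucl_dist_line1 y z s : eucl_dist (line y z s) z = `|1 - s| * eucl_dist y z.
Proof. by rewrite -{2}(line1 y z) eucl_dist_line distrC. Qed.

Lemma disc_convex c t y z s : 0 < t -> disc c t y -> disc c t z -> 0 <= s <= 1 ->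
  disc c t (line y z s).
Proof.
move=> t0; rewrite /disc/= !eucl_dist_lt//= => yc zc /andP[s0 s1].
have := @quadratic_between _ (y.1 - c.1) (y.2 - c.2) (z.1 - y.1) (z.2 - y.2) 0 1 s _ s0 s1.
rewrite !mulr0 !mulr1 !addr0 => /(_ (t ^+ 2) yc).
rewrite (_ : y.1 - c.1 + (z.1 - y.1) = z.1 - c.1); last by ring.
rewrite (_ : y.2 - c.2 + (z.2 - y.2) = z.2 - c.2); last by ring.
move=> /(_ zc); apply: le_lt_trans; rewrite le_eqVlt; apply/orP; left; apply/eqP; ring.
Qed.

End lines.

Section complement_component.
Context {R : realType}.
Local Notation lam2 := (@lebesgue_measure R \x @lebesgue_measure R)%E.
Local Notation plane := (measurableTypeR R * measurableTypeR R)%type.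
Variables (T : set (R * R)) (o : R * R).
Hypothesis cT : closed T.
Let D := connected_component (~` T) o.
Implicit Types (c d x y z : R * R) (s u t r : R).

Lemma component_outside y : D y -> ~ T y.
Proof. exact: connected_component_sub. Qed.

Lemma component_line y z : D y -> (forall s, 0 <= s <= 1 -> ~ T (line y z s)) -> D z.
Proof.
move=> Dy yzT.
apply: (connected_component_trans Dy).
apply: (@connected_component_max _ _ (line y z @` `[0, 1])).
- by exists 0; rewrite ?line0//= in_itv/= lexx ler01.
- by move=> _ [s /= s01 <-]; apply: yzT; move: s01; rewrite in_itv.
- apply: connected_continuous_connected; first exact: segment_connected.
  by apply: continuous_subspaceT; exact: line_continuous.
- by exists 1; rewrite ?line1//= in_itv/= lexx ler01.
Qed.

Lemma component_disc c t d : 0 < t -> disc c t d -> D d -> disc c t `<=` ~` T ->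
  disc c t `<=` D.
Proof.
move=> t0 cd Dd cT' z cz; apply: (component_line Dd) => s s01.
by apply: cT'; exact: disc_convex.
Qed.

Lemma outside_near y : ~ T y -> exists2 e, 0 < e & disc y e `<=` ~` T.
Proof.
by move=> Ty; apply/nbhs_discP; apply: open_nbhs_nbhs; split => //; exact: closed_openC.
Qed.

Lemma component_open : open D.
Proof.
rewrite openE => y Dy; have [e e0 eT] := outside_near (component_outside Dy).
apply/nbhs_discP; exists e => //; apply: component_disc Dy eT => //.
by rewrite /disc/= eucl_distxx.
Qed.

(** From a point of [D] farther than [t] from [c], the ray pointing away from [c] never meets [T],
    so [D] would be unbounded. *)
Lemma component_bounded_by c t : 0 <= t -> bounded_set D -> (forall x, T x -> eucl_dist x c <= t) ->
  forall x, D x -> eucl_dist x c <= t.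
Proof.
move=> t0 /bounded_planeP[M DM] Tct y Dy; rewrite leNgt; apply/negP => tyc.
have yc0 : 0 < eucl_dist c y by rewrite eucl_distC (le_lt_trans t0).
(* Chosen so that [line c y (1 + s)] is farther from [c] than any point of the box containing
   [D]. *)
pose s := (2 * `|M| + `|c.1| + `|c.2|) / eucl_dist c y + 1.
have s0 : 0 < s by rewrite ltr_wpDl// divr_ge0 ?eucl_dist_ge0 ?addr_ge0 ?mulr_ge0.
have : D (line c y (1 + s)).
  apply: (component_line Dy) => u /andP[u0 u1] /Tct.
  have -> : line y (line c y (1 + s)) u = line c y (1 + u * s).
    by rewrite /line/=; congr pair; ring.
  have us0 : 0 <= u * s by rewrite mulr_ge0// ltW.
  rewrite eucl_dist_line0 ger0_norm ?addr_ge0// leNgt => /negP; apply.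
  by apply: (lt_le_trans tyc); rewrite eucl_distC ler_peMl ?eucl_dist_ge0// lerDl.
move=> /DM[h1 h2].
have := eucl_dist_le_sum (line c y (1 + s)) c.
rewrite eucl_dist_line0 gtr0_norm; last by lra.
rewrite leNgt => /negP; apply.
apply: (@le_lt_trans _ _ (2 * `|M| + `|c.1| + `|c.2|)).
  have := ler_normB (line c y (1 + s)).1 c.1; have := ler_normB (line c y (1 + s)).2 c.2.
  have := ler_norm M; lra.
by rewrite -ltr_pdivrMr// /s; lra.
Qed.

(** Around a point of the circle off [T], some disc avoids [T] and meets [D]; the component would
    then contain that point. *)
Lemma circle_sub c r : 0 < r -> D = disc c r ->
  forall x, eucl_dist x c = r -> T x.
Proof.
move=> r0 Dcr x xc; apply: contrapT => /outside_near[e e0 eT].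
have er : 0 < r + e by rewrite addr_gt0.
(* Any [s] in []0, 1[] with [s * r < e] puts [line x c s] in both discs. *)
pose s := e / (r + e).
have s0 : 0 < s by rewrite divr_gt0.
have s1 : s < 1 by rewrite ltr_pdivrMr// mul1r ltrDr.
have xs : disc x e (line x c s).
  rewrite /disc/= eucl_dist_line0 gtr0_norm// xc /s mulrAC ltr_pdivrMr//.
  by rewrite ltr_pM2l// ltrDl.
have Ds : D (line x c s).
  rewrite Dcr /disc/= eucl_dist_line1 gtr0_norm ?subr_gt0// xc.
  by rewrite gtr_pMl// gtrBl.
have : D x.
  by apply: (component_disc e0 xs Ds eT); rewrite /disc/= eucl_distxx.
by rewrite Dcr /disc/= xc ltxx.
Qed.

End complement_component.

(** * Lower bounds on the length *)

Section largest_disc.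
Context {R : realType}.
Local Notation lam2 := (@lebesgue_measure R \x @lebesgue_measure R)%E.
Local Notation plane := (measurableTypeR R * measurableTypeR R)%type.
Implicit Types (S D : set (R * R)) (x y z : R * R) (e r t : R).

Lemma plane_measure_two_discs S x y r e : 0 < r -> 0 < e ->
  measurable (S : set plane) -> disc x r `<=` S -> disc y e `<=` S ->
  r + e <= eucl_dist x y -> ((pi * (r ^+ 2 + e ^+ 2))%:E <= lam2 S)%E.
Proof.
move=> r0 e0 mS xS yS xy.
have mr := measurable_disc x r; have me := measurable_disc y e.
have xy0 : disc x r `&` disc y e = set0.
  rewrite -subset0 => p []; rewrite /disc/= => px py.
  by have := eucl_dist_triangle p x y; rewrite (eucl_distC x p); lra.
rewrite mulrDr EFinD -(plane_measure_disc x r0) -(plane_measure_disc y e0).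
rewrite -(measureU lam2 mr me xy0).
apply: (le_measure lam2 (mem_set (measurableU _ _ mr me)) (mem_set mS)).
by rewrite subUset.
Qed.

Lemma largest_disc D r : bounded_set D -> 0 < r ->
  (forall t, 0 < t < r -> exists x, disc x t `<=` D) -> exists x, disc x r `<=` D.
Proof.
move=> /bounded_planeP[M DM] r0 Dr.
(* The shift by two keeps [t 0] positive. The required centre is a cluster point of the centres
   [x n]. *)
pose t (n : nat) := r - r / n.+2%:R.
have t0r n : 0 < t n < r.
  rewrite /t subr_gt0 gtrBl divr_gt0// andbT ltr_pdivrMr// ltr_pMr// ltr1n//.
have /choice[x xD] : forall n, exists x, disc x (t n) `<=` D by move=> n; exact: Dr.
pose K : set (R * R) := `[- M, M]%classic `*` `[- M, M]%classic.
have cK : compact K by apply: compact_setX; exact: segment_compact.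
have xK n : K (x n).
  have /DM[] : D (x n) by apply: (xD n); rewrite /disc/= eucl_distxx; case/andP: (t0r n).
  by rewrite !ler_norml /K/= !in_itv/=.
have xF : ProperFilter (x n @[n --> \oo]) by exact: fmap_proper_filter.
have [|p [_ pcl]] := cK (x n @[n --> \oo]) xF.
  by exists 0 => // n _; exact: xK.
exists p => y; rewrite /disc/= => yp.
pose e := (r - eucl_dist y p) / 2.
have e0 : 0 < e by rewrite divr_gt0// subr_gt0.
have [n0 n0P] : exists n0 : nat, r / n0.+2%:R < e.
  exists (Num.trunc (r / e)); rewrite ltr_pdivrMr// mulrC -ltr_pdivrMr//.
  have re0 : 0 <= r / e by rewrite divr_ge0 ?ltW.
  have /andP[_ h] := truncn_itv re0.
  by apply: (lt_trans h); rewrite ltr_nat.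
have tail : nbhs (x n @[n --> \oo]) (x @` [set n | (n0 <= n)%N]).
  by exists n0 => // n /= n0n; exists n.
have pe : nbhs p (disc p e) by apply/nbhs_discP; exists e.
have [_ [[n n0n <-]]] := pcl _ _ tail pe.
rewrite /disc/= => xnp; apply: (xD n); rewrite /disc/=.
have := eucl_dist_triangle p y (x n); rewrite (eucl_distC p (x n)).
have : r / n.+2%:R <= r / n0.+2%:R.
  by rewrite ler_pM2l// lef_pV2 ?posrE// ler_nat.
have : 2 * e = r - eucl_dist y p by rewrite /e mulrC divfK.
rewrite /t; move: (r / n.+2%:R) (r / n0.+2%:R) n0P => u v.
by move: xnp; clearbody e; lra.
Qed.

(** A point of [D] outside the disc would leave room in [D] for a second, disjoint disc, making the
    area too large. *)
Lemma disc_full_measure D x r : open D -> 0 < r -> disc x r `<=` D ->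
  lam2 D = (pi * r ^+ 2)%:E -> D = disc x r.
Proof.
move=> oD r0 xD DA; apply/seteqP; split => // y Dy.
apply: contrapT; rewrite /disc/= => /negP; rewrite -leNgt => ryx.
have yx0 : 0 < eucl_dist x y by rewrite eucl_distC (lt_le_trans r0).
have [e e0 eD] : exists2 e, 0 < e & disc y e `<=` D.
  by apply/nbhs_discP; exact: open_nbhs_nbhs.
(* [z] is [y] pushed away from [x] by [e / 2], so that the disc of radius [e / 2] around [z] misses
   [disc x r] and stays in [disc y e]. *)
pose s := e / 2 / eucl_dist x y.
have s0 : 0 < s by rewrite !divr_gt0.
pose z := line x y (1 + s).
have zx : eucl_dist z x = eucl_dist x y + e / 2.
  rewrite /z eucl_dist_line0 gtr0_norm ?addr_gt0// /s mulrDl mul1r.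
  by rewrite divfK// gt_eqF.
have zy : eucl_dist z y = e / 2.
  rewrite /z eucl_dist_line1 opprD addrA subrr add0r normrN gtr0_norm// /s.
  by rewrite divfK// gt_eqF.
have := @plane_measure_two_discs D x z r (e / 2) r0 _ _ xD.
rewrite DA lee_fin ler_pM2l ?pi_gt0// => h.
have : r ^+ 2 + (e / 2) ^+ 2 <= r ^+ 2.
  apply: h; first by rewrite divr_gt0.
  - exact: open_measurable2.
  - move=> w; rewrite /disc/= => wz; apply: eD; rewrite /disc/=.
    by have := eucl_dist_triangle z w y; lra.
  - by rewrite eucl_distC zx lerD2r eucl_distC.
by rewrite gerDl leNgt exprn_gt0// divr_gt0.
Qed.

End largest_disc.

Section plane_points.
Context {R : realType}.
Local Notation lam2 := (@lebesgue_measure R \x @lebesgue_measure R)%E.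
Local Notation plane := (measurableTypeR R * measurableTypeR R)%type.

Lemma eucl_dist0_eq (x y : R * R) : eucl_dist x y = 0 -> x = y.
Proof.
move=> xy; have := eucl_dist_ge1 x y; have := eucl_dist_ge2 x y.
rewrite xy !normr_le0 !subr_eq0 => /eqP; case: x y {xy} => [x1 x2] [y1 y2] /= ->.
by move=> /eqP ->.
Qed.

Let plane_set1E (x : R * R) : [set x] = [set x.1] `*` [set x.2].
Proof. by apply/seteqP; split => [_ ->//|[y z] /= [-> ->]]; case: x. Qed.

Lemma plane_measurable_set1 (x : R * R) : measurable ([set x] : set plane).
Proof. by rewrite plane_set1E; apply: measurableX; exact: measurable_set1. Qed.

Lemma plane_measure_set1 (x : R * R) : lam2 [set x] = 0%E.
Proof.
rewrite plane_set1E product_measure1E; [|exact: measurable_set1..].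
by rewrite [X in (X * _)%E]lebesgue_measure_set1 mul0e.
Qed.

End plane_points.

(** * Straddling centres near the enclosed domain *)

Section isoperimetric_inequality.
Context {R : realType}.
Local Notation lam2 := (@lebesgue_measure R \x @lebesgue_measure R)%E.
Local Notation plane := (measurableTypeR R * measurableTypeR R)%type.
Variables (a b : R) (g : R -> R * R) (o : R * R) (L r : R).
Hypotheses (ab : a < b) (cg : {within `[a, b], continuous g}) (gab : g a = g b).
Hypothesis gL : curve_length a b g = L%:E.
Let D := connected_component (~` trace a b g) o.
Hypotheses (bD : bounded_set D) (r0 : 0 < r) (DA : lam2 D = (pi * r ^+ 2)%:E).

Lemma trace_closed : closed (trace a b g).
Proof.
apply: compact_closed; first exact: norm_hausdorff.
by apply: continuous_compact => //; exact: segment_compact.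
Qed.

Let oD : open D. Proof. exact: component_open trace_closed. Qed.

Lemma straddlingP t x : (exists2 y, trace a b g y & eucl_dist y x < t) ->
  (exists2 y, trace a b g y & t < eucl_dist y x) -> straddling a b g t x.
Proof.
by move=> [_ [s sab <-] h] [_ [u uab <-] h']; split;
  [exists s|exists u] => //; rewrite /disc/= eucl_distC.
Qed.

Lemma length_gt_no_disc t : 0 < t < r -> (forall x, ~ disc x t `<=` D) ->
  2 * pi * r < L.
Proof.
move=> /andP[t0 tr] nD; have pi0 : 0 < pi :> R by exact: pi_gt0.
have : (lam2 (neighborhood D t) <= lam2 (straddling a b g t))%E.
  apply: (le_measure lam2 (mem_set (open_measurable2 (@neighborhood_open _ _ _)))
    (mem_set (open_measurable2 (@straddling_open _ _ _ _ _)))).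
  move=> x [d Dd xd]; apply: straddlingP; apply: contrapT => h.
    apply: (nD x); apply: (@component_disc _ _ _ _ _ d) => //.
      by rewrite /disc/= eucl_distC.
    by move=> y xy Ty; apply: h; exists y.
  (* If the curve stayed within [t] of [x], so would [D], whose area is too large for that. The open
     disc of intermediate radius [(t + r) / 2] contains the closed one. *)
  have DT : forall y, D y -> eucl_dist y x <= t.
    apply: component_bounded_by (ltW t0) bD _.
    by move=> y Ty; rewrite leNgt; apply/negP => ty; apply: h; exists y.
  have : (lam2 D <= lam2 (disc x ((t + r) / 2)))%E.
    apply: (le_measure lam2 (mem_set (open_measurable2 oD)) (mem_set (measurable_disc _ _))).
    by move=> y /DT; rewrite /disc/=; lra.
  rewrite DA plane_measure_disc; last by lra.
  by rewrite lee_fin ler_pM2l//; nra.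
move=> /(le_trans (brunn_minkowski_disc oD bD t0 r0 DA)).
move=> /le_trans/(_ (measure_straddling ab cg gab gL t0)); rewrite lee_fin => h.
(* Since [(r + t)^2 = 4 r t + (r - t)^2], this term makes the bound strict. *)
have : 0 < pi * (r - t) ^+ 2 by rewrite mulr_gt0// exprn_gt0// subr_gt0.
rewrite (ltNge (2 * pi * r)) => rt; apply/negP => Lr.
by have := ler_wpM2l (ltW t0) Lr; move: h rt; lra.
Qed.

Section round_domain.
Variable c : R * R.
Hypothesis Dc : D = disc c r.

Lemma trace_circle x : eucl_dist x c = r -> trace a b g x.
Proof. by apply: circle_sub Dc x => //; exact: trace_closed. Qed.

(** The line through [c] and [x] meets the circle at distances [|r - rho|] and [r + rho] from [x];
    for [0 < rho < 2 r] these lie on either side of [r]. *)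
Lemma punctured_disc_straddling : disc c (2 * r) `<=` straddling a b g r `|` [set c].
Proof.
move=> x; have [/eucl_dist0_eq ->|xc] := eqVneq (eucl_dist c x) 0; first by right.
move=> x2r; left; set rho := eucl_dist c x in xc.
have rho0 : 0 < rho by rewrite lt_neqAle eq_sym xc eucl_dist_ge0.
have rho2 : rho < 2 * r by rewrite /rho eucl_distC.
have r_rho : r / rho * rho = r by rewrite divfK.
have circ s : `|s| = r / rho -> trace a b g (line c x s).
  by move=> sr; apply: trace_circle; rewrite eucl_dist_line0 sr r_rho.
have rr0 : 0 < r / rho by rewrite divr_gt0.
apply: straddlingP.
  exists (line c x (r / rho)); first by apply: circ; rewrite gtr0_norm.
  rewrite eucl_dist_line1 -/rho -[X in _ * X]gtr0_norm// -normrM mulrBl mul1r r_rho.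
  by rewrite ltr_norml; lra.
exists (line c x (- (r / rho))); first by apply: circ; rewrite normrN gtr0_norm.
rewrite eucl_dist_line1 opprK -/rho gtr0_norm ?addr_gt0// mulrDl mul1r r_rho.
by rewrite ltrDr.
Qed.

Let mSc : measurable (straddling a b g r `|` [set c] : set plane).
Proof.
apply: measurableU; first by apply: open_measurable2; exact: straddling_open.
exact: plane_measurable_set1.
Qed.

Lemma measure_straddling_center :
  (lam2 (straddling a b g r `|` [set c]) <= (2 * r * L)%:E)%E.
Proof.
rewrite measureU0.
- exact: measure_straddling.
- by apply: open_measurable2; exact: straddling_open.
- exact: plane_measurable_set1.
- exact: plane_measure_set1.
Qed.

Lemma length_ge_disc : 2 * pi * r <= L.
Proof.
have : (lam2 (disc c (2 * r)) <= lam2 (straddling a b g r `|` [set c]))%E.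
  apply: (le_measure lam2 (mem_set (measurable_disc _ _)) (mem_set mSc)).
  exact: punctured_disc_straddling.
move=> /le_trans/(_ measure_straddling_center).
have r20 : 0 < 2 * r by rewrite mulr_gt0.
by rewrite plane_measure_disc// lee_fin => h; rewrite -(ler_pM2l r20); lra.
Qed.

(* A point of the curve outside the disc puts a disc of centres outside
   [disc c (2 * r)] into [straddling a b g r]. *)
Lemma length_gt_disc x : trace a b g x -> r < eucl_dist x c -> 2 * pi * r < L.
Proof.
move=> Tx; rewrite eucl_distC => rx; set d := eucl_dist c x in rx.
have d0 : 0 < d by rewrite (lt_trans r0).
(* [z] lies beyond [x] at distance [r - e], so [disc z e] is within [r] of [x]; [2 e <= d - r]
   separates it from [disc c (2 * r)], and [2 e <= r] keeps [s] positive. The circle point opposite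
   to [x] is the far one. *)
pose e := Num.min (d - r) r / 2.
have e0 : 0 < e by rewrite divr_gt0// lt_min subr_gt0 rx.
have er : 2 * e <= r by rewrite /e mulrC divfK// ge_min lexx orbT.
have ed : 2 * e <= d - r by rewrite /e mulrC divfK// ge_min lexx.
pose s := (r - e) / d.
have s0 : 0 < s by rewrite divr_gt0//; lra.
pose z := line c x (1 + s).
have sd : s * d = r - e by rewrite /s divfK// gt_eqF.
have zc : eucl_dist z c = d + r - e.
  by rewrite /z eucl_dist_line0 gtr0_norm ?addr_gt0// -/d mulrDl mul1r sd addrA.
have zx : eucl_dist z x = r - e.
  by rewrite /z eucl_dist_line1 opprD addrA subrr add0r normrN gtr0_norm.
have zS : disc z e `<=` straddling a b g r `|` [set c].
  move=> w; rewrite /disc/= => wz; left; apply: straddlingP.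
    exists x => //; have := eucl_dist_triangle z x w.
    by rewrite (eucl_distC x z) (eucl_distC z w); lra.
  have rd : r / d * d = r by rewrite divfK// gt_eqF.
  have rd0 : 0 < r / d by rewrite divr_gt0.
  exists (line c x (- (r / d))).
    by apply: trace_circle; rewrite eucl_dist_line0 normrN gtr0_norm.
  have := eucl_dist_triangle w (line c x (- (r / d))) z.
  rewrite eucl_dist_line -opprD normrN gtr0_norm; last by lra.
  by rewrite -/d !mulrDl mul1r rd sd; lra.
have r20 : 0 < 2 * r by rewrite mulr_gt0.
have := plane_measure_two_discs r20 e0 mSc punctured_disc_straddling zS.
rewrite eucl_distC zc => /(_ _)/le_trans/(_ measure_straddling_center).
rewrite lee_fin => h; have {}h : pi * ((2 * r) ^+ 2 + e ^+ 2) <= 2 * r * L by apply: h; lra.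
have pe : 0 < pi * e ^+ 2 by rewrite mulr_gt0 ?pi_gt0// exprn_gt0.
by rewrite -(ltr_pM2l r20); lra.
Qed.

End round_domain.

End isoperimetric_inequality.

(** * Length of a simple closed parametrization of a circle *)

Section circle_length.
Context {R : realType}.
Implicit Types (a b r s u x y : R) (g : R -> R * R) (c e : R * R).

Lemma norm_sin_le x : `|sin x| <= `|x|.
Proof.
wlog x0 : x / 0 <= x => [H|].
  have [/H//|/ltW x0] := leP 0 x.
  by rewrite -normrN -sinN -[leRHS]normrN; apply: H; rewrite oppr_ge0.
have [|v _] := @MVT_segment _ (@sin R) cos 0 x x0 (fun x _ => is_derive_sin x).
  by apply: continuous_subspaceT; exact: continuous_sin.
by rewrite sin0 !subr0 => ->; rewrite normrM ler_piMl// cos_max.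
Qed.

(** In complex notation, [c + exp (i x) e]. *)
Definition polar c e (x : R) : R * R :=
  (c.1 + (cos x * e.1 - sin x * e.2), c.2 + (cos x * e.2 + sin x * e.1)).

(** A chord is at most its arc: its length is [2 |e| |sin ((x - y) / 2)|]. *)
Lemma eucl_dist_polar c e x y :
  eucl_dist (polar c e x) (polar c e y) <= Num.sqrt (e.1 ^+ 2 + e.2 ^+ 2) * `|x - y|.
Proof.
have e0 : 0 <= e.1 ^+ 2 + e.2 ^+ 2 by rewrite addr_ge0 ?sqr_ge0.
rewrite -sqrtr_sqr -sqrtrM//; apply: ler_wsqrtr.
rewrite [leLHS](_ : _ = (e.1 ^+ 2 + e.2 ^+ 2) * ((cos x - cos y) ^+ 2 + (sin x - sin y) ^+ 2)).
  apply: ler_wpM2l => //.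
  have := cos2Dsin2 x; have := cos2Dsin2 y => h1 h2.
  have h : sin ((x - y) / 2) ^+ 2 <= ((x - y) / 2) ^+ 2.
    rewrite -[leLHS]real_normK ?num_real// -[leRHS]real_normK ?num_real//.
    by rewrite ler_pXn2r ?nnegrE// norm_sin_le.
  have : cos (x - y) = 1 - 2 * sin ((x - y) / 2) ^+ 2.
    rewrite {1}(_ : x - y = ((x - y) / 2) *+ 2); last by rewrite -mulr_natr; field.
    by rewrite cos_mulr2n cos2sin2 -mulr_natr; ring.
  by rewrite cosB; lra.
rewrite /polar/=; ring.
Qed.

Lemma polar_Npi c e : polar c e (- pi) = polar c e pi.
Proof. by rewrite /polar sinN cosN sinpi oppr0. Qed.

(* The angle of [(x, y)] seen from the point [(-1, 0)] of the unit circle is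
   half the angle seen from the centre. *)
Definition angle (x y : R) : R := atan (y / (1 + x)) *+ 2.

Lemma angle_bounds x y : - pi < angle x y < pi.
Proof.
have := atan_gtNpi2 (y / (1 + x)); have := atan_ltpi2 (y / (1 + x)).
by rewrite /angle -mulr_natr; lra.
Qed.

(** Double-angle formulas with [t] the tangent of the half angle, whose squared cosine is
    [(1 + x) / 2]. *)
Lemma cos_sin_angle x y : x ^+ 2 + y ^+ 2 = 1 -> x != -1 ->
  cos (angle x y) = x /\ sin (angle x y) = y.
Proof.
move=> xy xN1; have x1 : 1 + x != 0 by rewrite addrC -[1]opprK subr_eq0.
set t := y / (1 + x).
have tE : t * (1 + x) = y by rewrite divfK.
have t1 : (1 + t ^+ 2) * (1 + x) = 2.
  apply: (mulIf x1); rewrite -mulrA mulrDl -expr2 -exprMn tE; lra.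
have c0 : 0 < 1 + t ^+ 2 by rewrite ltr_pwDl// sqr_ge0.
have cE : cos (atan t) ^+ 2 = (1 + x) / 2.
  rewrite cos_atan exprVn sqr_sqrtr ?ltW//; have c1 : 1 + t ^+ 2 != 0 by rewrite gt_eqF.
  by apply: (mulfI c1); rewrite divff// mulrA t1 divff.
have cn0 : cos (atan t) != 0.
  by apply: contraNneq x1 => c00; move: cE; rewrite c00 expr0n/= => h; apply/eqP; lra.
have sE : sin (atan t) = t * cos (atan t).
  by rewrite -{2}(atanK t) /tan divfK.
rewrite /angle -/t cos_mulr2n sin_mulr2n sE !mulr2n; split.
  by rewrite cE; lra.
by rewrite mulrCA -expr2 cE -tE; lra.
Qed.

Lemma polygonal_length_le a b g (h : R -> R) r : 0 <= r ->
  (forall x y, a <= x <= b -> a <= y <= b -> x <= y ->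
     eucl_dist (g x) (g y) <= r * (h y - h x)) ->
  forall p, itv_partition a b p -> polygonal_length a g p <= r * (h b - h a).
Proof.
move=> r0 gh p pab; rewrite -(itv_partition_nth_size a pab).
have {2}-> : a = nth a (a :: p) 0 by [].
rewrite -(@telescope_sumr _ 0 (size p) (fun i => h (nth a (a :: p) i)))// mulr_sumr.
rewrite /polygonal_length; apply: ler_sum_nat => i /= ip.
have inab j : (j <= size p)%N -> a <= nth a (a :: p) j <= b.
  move=> jp; rewrite (set_nth_default b)//.
  by rewrite (itv_partition_nth_ge _ pab)// (itv_partition_nth_le _ pab).
apply: gh; [exact: inab (ltnW ip)|exact: (inab i.+1 ip)|].
by have [/(pathP a)/(_ i ip)/ltW] := pab.
Qed.

(** On the open parameter interval the angle is continuous and, by simplicity, injective, hence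
    monotone; its range has length at most [2 pi], and the arcs bounding the edges of any inscribed
    polygon telescope. *)
Lemma curve_length_circle a b g c r L : simple_closed_curve a b g -> 0 < r ->
  trace a b g = [set x | eucl_dist x c = r] -> curve_length a b g = L%:E ->
  L <= 2 * pi * r.
Proof.
move=> [ab cg gab ginj] r0 gT gL.
have pi0 : 0 < pi :> R by exact: pi_gt0.
rewrite -lee_fin -gL; apply: ub_ereal_sup => _ [p pab <-]; rewrite lee_fin.
(* Pointing away from [g a], [e] places the jump of the angle at [g a], which the curve visits only
   at the two ends. [X] and [Y] are the coordinates of [(g s - c) / e] as complex numbers. *)
pose e : R * R := (c.1 - (g a).1, c.2 - (g a).2).
have er : e.1 ^+ 2 + e.2 ^+ 2 = r ^+ 2.
  have : trace a b g (g a) by exists a; rewrite //= in_itv/= lexx ltW.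
  by rewrite gT /= => <-; rewrite eucl_dist_sqr /e/=; ring.
have dist_polar x y : eucl_dist (polar c e x) (polar c e y) <= r * `|x - y|.
  by have := eucl_dist_polar c e x y; rewrite er sqrtr_sqr gtr0_norm.
pose X s := (((g s).1 - c.1) * e.1 + ((g s).2 - c.2) * e.2) / r ^+ 2.
pose Y s := (((g s).2 - c.2) * e.1 - ((g s).1 - c.1) * e.2) / r ^+ 2.
have r20 : r ^+ 2 != 0 by rewrite sqrf_eq0 gt_eqF.
have gXY s : g s = (c.1 + (X s * e.1 - Y s * e.2), c.2 + (X s * e.2 + Y s * e.1)).
  rewrite [LHS]surjective_pairing; congr pair.
    rewrite /X /Y -er; field. by rewrite er.
  rewrite /X /Y -er; field. by rewrite er.
have XY s : a <= s <= b -> X s ^+ 2 + Y s ^+ 2 = 1.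
  move=> sab; have : trace a b g (g s) by exists s; rewrite //= in_itv.
  rewrite gT /= => gsr; apply: (mulIf r20); rewrite mul1r -{1}er.
  have := eucl_dist_sqr (g s) c; rewrite gsr {1 2}gXY/= => ->; ring.
have gpi : g a = polar c e pi.
  rewrite /polar cospi sinpi /e /= [LHS]surjective_pairing; congr pair; ring.
have XN1 s : a < s < b -> X s != -1.
  move=> /andP[as_ sb]; apply/eqP => XsN1.
  have Ys : Y s = 0.
    have := XY s; rewrite XsN1 sqrrN expr1n !ltW// => /(_ isT).
    by move=> /eqP; rewrite -subr_eq0 addrAC subrr add0r sqrf_eq0 => /eqP.
  have : s = a.
    apply: ginj; rewrite ?in_itv/= ?lexx ?ab ?(ltW as_)//.
    by rewrite gpi gXY XsN1 Ys /polar cospi sinpi.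
  by move=> sa; rewrite sa ltxx in as_.
pose th s := angle (X s) (Y s).
have gth s : a < s < b -> g s = polar c e (th s).
  move=> sab; have XYs : X s ^+ 2 + Y s ^+ 2 = 1.
    by apply: XY; case/andP: sab => /ltW -> /ltW ->.
  have [cE sE] := cos_sin_angle XYs (XN1 s sab).
  by rewrite /polar cE sE; exact: gXY.
have thpi s : - pi < th s < pi by exact: angle_bounds.
have cth : {within `]a, b[, continuous th}.
  apply: continuous_in_subspaceT => s; rewrite inE/= in_itv/= => sab.
  have cgs : g u @[u --> s] --> g s.
    move=> O Os; case/andP: (sab) => as_ sb.
    have [|d d0 dO] := within_itv_near cg _ Os; first by rewrite !ltW.
    have d'0 : 0 < Num.min d (Num.min (s - a) (b - s)) by rewrite !lt_min d0 !subr_gt0 as_.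
    apply/nbhs_ballP; exists (Num.min d (Num.min (s - a) (b - s))) => // u.
    rewrite /ball/= distrC !lt_min => /andP[ud /andP[ua ub]].
    apply: dO => //; move: ua ub; rewrite !ltr_norml => /andP[ua _] /andP[_ ub].
    by apply/andP; split; lra.
  have c1 : (g u).1 @[u --> s] --> (g s).1 by apply: (cvg_comp _ _ cgs); exact: cvg_fst.
  have c2 : (g u).2 @[u --> s] --> (g s).2 by apply: (cvg_comp _ _ cgs); exact: cvg_snd.
  have cX : X u @[u --> s] --> X s.
    apply: cvgMl; apply: cvgD; apply: cvgMl; apply: cvgB => //; exact: cvg_cst.
  have cY : Y u @[u --> s] --> Y s.
    apply: cvgMl; apply: cvgB; apply: cvgMl; apply: cvgB => //; exact: cvg_cst.
  have X1 : 1 + X s != 0 by rewrite addrC -[1]opprK subr_eq0 XN1.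
  have cX1 : (1 + X u) @[u --> s] --> 1 + X s by apply: cvgD => //; exact: cvg_cst.
  have q : (Y u / (1 + X u)) @[u --> s] --> Y s / (1 + X s) by exact: cvgM cY (cvgV X1 cX1).
  by apply: cvgMn; exact: (cvg_comp _ _ q (@continuous_atan R _)).
have ith : {in `]a, b[ &, injective th}.
  move=> s u; rewrite !in_itv/= => sab uab su.
  apply: ginj; rewrite ?in_itv/=.
  - by case/andP: sab => /ltW -> ->.
  - by case/andP: uab => /ltW -> ->.
  by rewrite !gth// su.
(* The sign [k] records the orientation: with these end values [k * h k] increases from [- pi] to
   [pi]. *)
pose h k s : R := if s == a then - k * pi else if s == b then k * pi else th s.
have ba : (b == a) = false by rewrite gt_eqF.
have gh k s : k = 1 \/ k = -1 -> a <= s <= b -> g s = polar c e (h k s).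
  move=> k1 /andP[as_ sb]; rewrite /h; have [->|sa] := eqVneq s a.
    by case: k1 => ->; rewrite ?opprK ?mulN1r ?mul1r ?polar_Npi.
  have [->|sb'] := eqVneq s b.
    by rewrite -gab; case: k1 => ->; rewrite ?mulN1r ?mul1r ?polar_Npi.
  by apply: gth; rewrite !lt_neqAle as_ sb sb' eq_sym sa.
have mono k : k = 1 \/ k = -1 ->
    (forall s u, a < s < b -> a < u < b -> s < u -> k * th s < k * th u) ->
    polygonal_length a g p <= 2 * pi * r.
  move=> k1 kth; have kk : k * k = 1 by case: k1 => ->; rewrite ?mulrNN mulr1.
  have kn : `|k| = 1 by case: k1 => ->; rewrite ?normrN1 ?normr1.
  have ha : k * h k a = - pi by rewrite /h eqxx mulNr mulrN mulrA kk mul1r.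
  have hb : k * h k b = pi by rewrite /h ba eqxx mulrA kk mul1r.
  have hs s : a < s < b -> h k s = th s.
    by move=> /andP[as_ sb]; rewrite /h gt_eqF// lt_eqF.
  have kpi s : a < s < b -> - pi < k * th s < pi.
    by move=> _; have := thpi s; case: k1 => ->; rewrite ?mulN1r ?mul1r; lra.
  have -> : 2 * pi * r = r * (k * h k b - k * h k a) by rewrite ha hb; ring.
  apply: (@polygonal_length_le _ _ _ (fun s => k * h k s)) => //; first exact: ltW.
  move=> x y xab yab xy; rewrite (gh k x)// (gh k y)//.
  apply: (le_trans (dist_polar _ _)); rewrite ler_pM2l//.
  rewrite distrC -mulrBr -[leLHS]mul1r -kn -normrM ger0_norm// mulrBr subr_ge0.
  case/andP: xab; rewrite le_eqVlt => /predU1P[<- xb|ax xb].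
    rewrite ha; case/andP: yab; rewrite le_eqVlt => /predU1P[<- _|ay]; first by rewrite ha.
    rewrite le_eqVlt => /predU1P[->|yb]; first by rewrite hb; lra.
    by rewrite hs ?ay//; have /andP[/ltW] := kpi y (introT andP (conj ay yb)).
  have ay : a < y by exact: lt_le_trans xy.
  case/andP: yab => _; rewrite le_eqVlt => /predU1P[yb|yb].
    rewrite yb hb; move: xb; rewrite le_eqVlt => /predU1P[->|xb]; first by rewrite hb.
    by rewrite hs ?ax//; have /andP[_ /ltW] := kpi x (introT andP (conj ax xb)).
  have xb' : x < b by exact: le_lt_trans yb.
  rewrite !hs ?ax ?ay//; move: xy; rewrite le_eqVlt => /predU1P[->//|xy].
  by apply: ltW; apply: kth; rewrite ?ax ?ay.
have [inc|dec] := itv_continuous_inj_mono cth ith.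
  apply: (mono 1); first by left.
  by move=> s u sab uab su; rewrite !mul1r inc// in_itv.
apply: (mono (-1)); first by right.
by move=> s u sab uab su; rewrite !mulN1r ltrN2 dec// in_itv.
Qed.

End circle_length.

Section enclosed_disc.
Context {R : realType}.
Implicit Types (T : set (R * R)) (o c : R * R) (r : R).

(** Boundedness rules out the exterior: the component stays in the closed disc, misses the circle,
    and fills the open disc by convexity. *)
Lemma component_circle T o c r : 0 < r -> T = [set x | eucl_dist x c = r] ->
  (~` T) o -> bounded_set (connected_component (~` T) o) ->
  connected_component (~` T) o = disc c r.
Proof.
move=> r0 TE To bD; set D := connected_component _ _ in bD *.
have Do : D o by exact: connected_component_refl.
have Dc y : D y -> disc c r y.
  move=> Dy; rewrite /disc/= lt_neqAle; apply/andP; split.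
    by apply/eqP => yc; apply: (component_outside Dy); rewrite TE.
  by apply: component_bounded_by (ltW r0) bD _ _ Dy => x; rewrite TE => /= ->.
apply/seteqP; split => //; apply: (component_disc r0 (Dc _ Do) Do).
by move=> x; rewrite TE /disc/= => + xc; rewrite xc ltxx.
Qed.

End enclosed_disc.

(** * Comparison with the disc of equal area *)

Theorem theorem1p1 (R : realType) (a b : R) (gamma : R -> R * R)
    (D : set (R * R)) (L A : R)
    (gamma_scc : simple_closed_curve a b gamma)
    (gamma_length : curve_length a b gamma = L%:E)
    (D_enclosed : enclosed_domain a b gamma D)
    (D_area : area D = A%:E) :
  4 * pi * A <= L ^+ 2 /\
  (L ^+ 2 = 4 * pi * A <-> is_circle (trace a b gamma)).
Proof.
have pi0 : 0 < pi :> R by exact: pi_gt0.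
have [ab cg gab _] := gamma_scc.
case: D_enclosed => bD [ o To DE]; subst D.
set T := trace a b gamma in To bD D_area *; set E := connected_component _ _ in bD D_area *.
have cT : closed T by exact: trace_closed.
have oE : open E by exact: component_open.
have Eo : E o by exact: connected_component_refl.
have A0 : 0 < A.
  have [e e0 eE] : exists2 e, 0 < e & disc o e `<=` E.
    by apply/nbhs_discP; exact: open_nbhs_nbhs.
  apply: (@lt_le_trans _ _ (pi * e ^+ 2)); first by rewrite mulr_gt0// exprn_gt0.
  rewrite -lee_fin -(plane_measure_disc o e0) -D_area.
  exact: (le_measure (@lebesgue_measure R \x @lebesgue_measure R)%E
    (mem_set (measurable_disc _ _)) (mem_set (open_measurable2 oE)) eE).
(* With the radius of the disc of area [A], the claim becomes a comparison of [L] with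
   [2 * pi * r]. *)
pose r := Num.sqrt (A / pi).
have r0 : 0 < r by rewrite sqrtr_gt0 divr_gt0.
have AE : A = pi * r ^+ 2.
  by rewrite sqr_sqrtr ?divr_ge0 ?ltW// mulrC divfK// gt_eqF.
have LE : 4 * pi * A = (2 * pi * r) ^+ 2 by rewrite AE; ring.
rewrite AE in D_area.
have [rL circle] : 2 * pi * r <= L /\ (L = 2 * pi * r -> is_circle T).
  have [[t [tr nE]]|nt] := pselect (exists t, 0 < t < r /\ forall x, ~ disc x t `<=` E).
    have rL := length_gt_no_disc ab cg gab gamma_length bD r0 D_area tr nE.
    by split; [exact: ltW|move=> LE'; rewrite LE' ltxx in rL].
  have [c cE] : exists c, disc c r `<=` E.
    apply: largest_disc => // t tr; apply: contrapT => nE; apply: nt.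
    by exists t; split => // x xE; apply: nE; exists x.
  have Ec := disc_full_measure oE r0 cE D_area.
  split; first exact: length_ge_disc Ec.
  move=> LE'; exists c, r; split => //; apply/seteqP; split => x /=; last first.
    exact: trace_circle Ec x.
  move=> Tx; apply/eqP; rewrite eq_le; apply/andP; split.
    rewrite leNgt; apply/negP => xr.
    have := length_gt_disc ab cg gab gamma_length r0 Ec Tx xr.
    by rewrite LE' ltxx.
  (* A point of the curve inside the circle would belong to [E], which avoids the curve. *)
  rewrite leNgt; apply/negP => xr.
  by apply: (@component_outside _ T o x) Tx; rewrite -/E Ec.
have r20 : 0 <= 2 * pi * r by rewrite !mulr_ge0// ltW.
rewrite LE ler_pXn2r ?nnegrE ?(le_trans r20)//; split => //; split.
  by move=> /eqP; rewrite eqrXn2// ?(le_trans r20)// => /eqP; exact: circle.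
move=> [c [s [s0 Ts]]]; have Es := component_circle s0 Ts To bD.
have sr : s = r.
  move: D_area; rewrite /area -/E /E Es plane_measure_disc// => -[].
  move=> /(mulfI (lt0r_neq0 pi0))/eqP; rewrite eqrXn2// ?ltW// => /eqP.
  by [].
have := curve_length_circle gamma_scc s0 Ts gamma_length.
by rewrite sr => Lr; congr (_ ^+ 2); apply/eqP; rewrite eq_le Lr rL.
Qed.
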